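(* Let $K$ be an algebraically closed field with $p=\operatorname{char} K\neq 2,3$. Then $$\dim F^{l_1,\ldots,l_r}(r)=\binom{l_1+\cdots+l_r}{l_1\ \cdots\ l_r}+(l_1+1)\cdots(l_r+1)-\binom{r+1}{2}-r-1+w,$$ where $w=w(l_1,\ldots,l_r)$ is the number of $1$'s in the sequence $l_1,\ldots,l_r$; $$\dim F_n(r)=r^n+\binom{n+2r-1}{n}-\binom{r+1}{2}\binom{n+r-3}{n-2}-r\binom{n+r-2}{n-1}-\binom{n+r-1}{n};$$ and $$\dim F_n^{multi}=n!+2^n-\binom{n+1}{2}-1.$$
   Context: A (nonassociative) $K$-algebra is called assosymmetric if $(a,b,c)=(a,c,b)=(b,a,c)$ for all its elements $a,b,c$, where $(x,y,z)=(xy)z-x(yz)$ is the associator. The free assosymmetric algebra on a set $X$ is the quotient of the absolutely free nonassociative $K$-algebra $K\{X\}$ (without unit) by the ideal of all polynomial identities satisfied by every assosymmetric algebra. $F(r)$ denotes the free assosymmetric algebra generated by $r$ elements $a_1,\ldots,a_r$. $F^{l_1,\ldots,l_r}(r)$ is the subspace of $F(r)$ spanned by the (arbitrarily bracketed) monomials in which each generator $a_i$ occurs exactly $l_i$ times, $i=1,\ldots,r$. $F_n(r)$ is the subspace of $F(r)$ of elements of degree $n$, where $n$ is a positive integer. $F_n^{multi}=F^{1,\ldots,1}(n)$ is the multilinear part of $F_n(n)$. The symbol $\binom{l_1+\cdots+l_r}{l_1\ \cdots\ l_r}=\frac{(l_1+\cdots+l_r)!}{l_1!\cdots l_r!}$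 is the multinomial coefficient, and binomial coefficients with negative lower index are zero. Dimensions are over $K$.
   Formalization: The first formula is stated for r ≥ 1 and all l_i ≥ 1, since it fails when some l_i = 0 (for r = 2, l = (1,0) it gives −2, while the dimension is 1); the second formula is stated for r ≥ 1. *)

(* Defs.v *)
From HB Require Import structures.
From mathcomp Require Import all_boot all_algebra.
From mathcomp Require Import boolp.
From mathcomp Require Import finmap.
From mathcomp.multinomials Require Import monalg.

Set Implicit Arguments.
Unset Strict Implicit.
Unset Printing Implicit Defensive.

Import GRing.Theory.
Local Open Scope ring_scope.
Local Open Scope quotient_scope.

(* Nonassociative algebras are neither assumed associative nor unital. *)
HB.mixin Record Lmodule_isNAAlgebra (K : fieldType) A of GRing.Lmodule K A := {
  amul : A -> A -> A;
  amulDl : forall x y z, amul (x + y) z = amul x z + amul y z;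
  amulDr : forall x y z, amul x (y + z) = amul x y + amul x z;
  amulZl : forall (c : K) x y, amul (c *: x) y = c *: amul x y;
  amulZr : forall (c : K) x y, amul x (c *: y) = c *: amul x y
}.

#[short(type="naAlgType")]
HB.structure Definition NAAlgebra (K : fieldType) :=
  { A of GRing.Lmodule K A & Lmodule_isNAAlgebra K A }.

HB.lock Definition associator (K : fieldType) (A : naAlgType K) (x y z : A) : A :=
  amul (amul x y) z - amul x (amul y z).

Canonical associator_unlockable := Unlockable associator.unlock.

Section NAAlgebraTheory.
Variables (K : fieldType) (A : naAlgType K).

Definition assosymmetric : Prop := forall a b c : A,
  associator a b c = associator a c b /\ associator a b c = associator b a c.

Lemma amul0l (x : A) : amul 0 x = 0.
Proof. by rewrite -[X in amul X _](scale0r (0 : A)) amulZl scale0r. Qed.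

Lemma amul0r (x : A) : amul x 0 = 0.
Proof. by rewrite -[X in amul _ X](scale0r (0 : A)) amulZr scale0r. Qed.

Lemma amulBl (x y z : A) : amul (x - y) z = amul x z - amul y z.
Proof. by rewrite amulDl -scaleN1r amulZl scaleN1r. Qed.

Lemma amulBr (x y z : A) : amul x (y - z) = amul x y - amul x z.
Proof. by rewrite amulDr -scaleN1r amulZr scaleN1r. Qed.

End NAAlgebraTheory.

Inductive word (X : Type) := Letter of X | Node of word X & word X.

Fixpoint letters (X : Type) (w : word X) : seq X :=
  match w with
  | Letter x => [:: x]
  | Node u v => letters u ++ letters v
  end.

Section WordChoice.
Variable X : choiceType.

Fixpoint tree_of_word (w : word X) : GenTree.tree X :=
  match w with
  | Letter x => GenTree.Leaf x
  | Node u v => GenTree.Node 0 [:: tree_of_word u; tree_of_word v]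
  end.

Fixpoint word_of_tree (t : GenTree.tree X) : option (word X) :=
  match t with
  | GenTree.Leaf x => Some (Letter x)
  | GenTree.Node _ [:: t1; t2] =>
      if (word_of_tree t1, word_of_tree t2) is (Some u, Some v)
      then Some (Node u v) else None
  | GenTree.Node _ _ => None
  end.

Lemma tree_of_wordK : pcancel tree_of_word word_of_tree.
Proof. by elim=> //= u -> v ->. Qed.

HB.instance Definition _ := Choice.copy (word X) (pcan_type tree_of_wordK).

End WordChoice.

Fixpoint word_eval (K : fieldType) (A : naAlgType K) (X : Type) (a : X -> A)
    (w : word X) : A :=
  match w with
  | Letter x => a x
  | Node u v => amul (word_eval a u) (word_eval a v)
  end.

(* The linear extension of a map defined on the basis. It is locked, as is
   the associator, because conversion would otherwise unfold finitely supported
   sums. *)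
HB.lock Definition linext (K : fieldType) (G : choiceType) (V : lmodType K)
    (h : G -> V) (f : {malg K[G]}) : V := \sum_(g <- msupp f) f@_g *: h g.

Canonical linext_unlockable := Unlockable linext.unlock.

Section LinearExtension.
Variables (K : fieldType) (G : choiceType) (V : lmodType K) (h : G -> V).

Local Notation linext := (linext h).

Lemma linextEw (f : {malg K[G]}) (s : {fset G}) :
  (msupp f `<=` s)%fset -> linext f = \sum_(g <- s) f@_g *: h g.
Proof.
move=> fs; rewrite !linext.unlock (big_fset_incl _ fs) // => g _ gf.
by rewrite mcoeff_outdom // scale0r.
Qed.

Lemma linextD f g : linext (f + g) = linext f + linext g.
Proof.
pose s := (msupp f `|` msupp g)%fset.
rewrite (linextEw (msuppD_le f g)) (linextEw (fsubsetUl _ _ : msupp f `<=` s)%fset).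
rewrite (linextEw (fsubsetUr _ _ : msupp g `<=` s)%fset) -big_split /=.
by apply: eq_bigr => u _; rewrite mcoeffD scalerDl.
Qed.

Lemma linext0 : linext 0 = 0.
Proof. by rewrite !linext.unlock msupp0 big_seq_fset0. Qed.

Lemma linextZ c f : linext (c *: f) = c *: linext f.
Proof.
rewrite (linextEw (msuppZ_le c f)) linext.unlock scaler_sumr.
by apply: eq_bigr => u _; rewrite mcoeffZ scalerA.
Qed.

Lemma linextU c g : linext << c *g g >> = c *: h g.
Proof.
rewrite (linextEw msuppU_le) big_seq_fset1.
by rewrite mcoeffUU.
Qed.

End LinearExtension.

Lemma eq_linext (K : fieldType) (G : choiceType) (V : lmodType K)
    (h k : G -> V) (f : {malg K[G]}) : h =1 k -> linext h f = linext k f.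
Proof. by move=> hk; rewrite !linext.unlock; apply: eq_bigr => g _; rewrite hk. Qed.

Lemma linext_comp (K : fieldType) (G : choiceType) (V W : lmodType K)
    (h : G -> V) (k : V -> W) (f : {malg K[G]}) :
    (forall x y, k (x + y) = k x + k y) ->
    (forall c x, k (c *: x) = c *: k x) ->
  k (linext h f) = linext (k \o h) f.
Proof.
move=> kD kZ; have k0 : k 0 = 0 by rewrite -[X in k X](scale0r (0 : V)) kZ scale0r.
rewrite !linext.unlock (big_morph k kD k0).
by apply: eq_bigr => g _; rewrite kZ.
Qed.

Lemma linext_addf (K : fieldType) (G : choiceType) (V : lmodType K)
    (h1 h2 : G -> V) (f : {malg K[G]}) :
  linext (fun g => h1 g + h2 g) f = linext h1 f + linext h2 f.
Proof.
by rewrite !linext.unlock -big_split; apply: eq_bigr => g _; rewrite scalerDr.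
Qed.

Lemma linext_scalef (K : fieldType) (G : choiceType) (V : lmodType K)
    (h : G -> V) (c : K) (f : {malg K[G]}) :
  linext (fun g => c *: h g) f = c *: linext h f.
Proof.
by rewrite !linext.unlock scaler_sumr; apply: eq_bigr => g _; rewrite !scalerA mulrC.
Qed.

(* The absolutely free nonassociative algebra K{X}, without unit: formal
   K-linear combinations of (nonempty) bracketed words in X. *)
Definition freeNA (K : fieldType) (X : choiceType) : Type := {malg K[word X]}.

HB.instance Definition _ K X := GRing.Lmodule.on (freeNA K X).

Section FreeNA.
Variables (K : fieldType) (X : choiceType).
Implicit Types f g : freeNA K X.

Definition freeNA_mul f g : freeNA K X :=
  linext (fun u => linext (fun v => << Node u v >> : freeNA K X) g) f.

Lemma freeNA_mulDl f1 f2 g :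
  freeNA_mul (f1 + f2) g = freeNA_mul f1 g + freeNA_mul f2 g.
Proof. exact: linextD. Qed.

Lemma freeNA_mulDr f g1 g2 :
  freeNA_mul f (g1 + g2) = freeNA_mul f g1 + freeNA_mul f g2.
Proof.
rewrite /freeNA_mul -linext_addf.
by apply: eq_linext => u; rewrite linextD.
Qed.

Lemma freeNA_mulZl c f g : freeNA_mul (c *: f) g = c *: freeNA_mul f g.
Proof. exact: linextZ. Qed.

Lemma freeNA_mulZr c f g : freeNA_mul f (c *: g) = c *: freeNA_mul f g.
Proof.
rewrite /freeNA_mul -linext_scalef.
by apply: eq_linext => u; rewrite linextZ.
Qed.

HB.instance Definition _ := Lmodule_isNAAlgebra.Build K (freeNA K X)
  freeNA_mulDl freeNA_mulDr freeNA_mulZl freeNA_mulZr.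

Definition freeNA_eval (A : naAlgType K) (a : X -> A) (f : freeNA K X) : A :=
  linext (word_eval a) f.

Lemma freeNA_evalM (A : naAlgType K) (a : X -> A) f g :
  freeNA_eval a (amul f g) = amul (freeNA_eval a f) (freeNA_eval a g).
Proof.
pose ev := freeNA_eval a.
have evD x y : ev (x + y) = ev x + ev y by exact: linextD.
have evZ c x : ev (c *: x) = c *: ev x by exact: linextZ.
rewrite -/(ev _) /amul /= /freeNA_mul (linext_comp _ _ evD evZ).
transitivity (linext (fun u => amul (word_eval a u) (ev g)) f); last first.
  have kD x y := amulDl x y (ev g).
  have kZ c x := amulZl c x (ev g).
  exact: esym (linext_comp (word_eval a) f kD kZ).
apply: eq_linext => u /=.
rewrite (linext_comp _ _ evD evZ).
rewrite (linext_comp _ _ (amulDr (word_eval a u))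
                         (fun c => amulZr c (word_eval a u))).
apply: eq_linext => v /=.
by rewrite /ev /freeNA_eval linextU scale1r.
Qed.

Definition assosym_identity (f : freeNA K X) : Prop :=
  forall A : naAlgType K, assosymmetric A ->
  forall a : X -> A, freeNA_eval a f = 0.

Definition assosym_ideal : {pred freeNA K X} :=
  fun f => `[< assosym_identity f >].

Lemma assosym_ideal_zmod_closed : zmod_closed assosym_ideal.
Proof.
split=> [|f g /asboolP fI /asboolP gI]; apply/asboolP => A Aas a.
  exact: linext0.
rewrite /freeNA_eval linextD -scaleN1r linextZ.
by have := fI A Aas a; have := gI A Aas a; rewrite /freeNA_eval => -> ->; rewrite scaler0 addr0.
Qed.

HB.instance Definition _ :=
  GRing.isZmodClosed.Build (freeNA K X) assosym_ideal assosym_ideal_zmod_closed.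

Lemma assosym_idealZ c f : f \in assosym_ideal -> c *: f \in assosym_ideal.
Proof.
move=> /asboolP fI; apply/asboolP => A Aas a.
by rewrite /freeNA_eval linextZ; have := fI A Aas a; rewrite /freeNA_eval => ->; rewrite scaler0.
Qed.

Lemma assosym_idealMl f g : f \in assosym_ideal -> amul f g \in assosym_ideal.
Proof.
by move=> /asboolP fI; apply/asboolP => A Aas a; rewrite freeNA_evalM fI // amul0l.
Qed.

Lemma assosym_idealMr f g : g \in assosym_ideal -> amul f g \in assosym_ideal.
Proof.
by move=> /asboolP gI; apply/asboolP => A Aas a; rewrite freeNA_evalM gI // amul0r.
Qed.

End FreeNA.

Arguments assosym_ideal {K X}.

Definition freeAssosym (K : fieldType) (X : choiceType) : Type :=
  Quotient.quot (@assosym_ideal K X).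

HB.instance Definition _ K X := GRing.Zmodule.on (freeAssosym K X).
HB.instance Definition _ K X := EqQuotient.on (freeAssosym K X).

Section FreeAssosym.
Variables (K : fieldType) (X : choiceType).
Local Notation F := (freeAssosym K X).
Implicit Types f g : freeNA K X.

Definition proj f : F := \pi_F f.

Lemma projP f g : (proj f = proj g) <-> (f - g \in assosym_ideal).
Proof. by rewrite Quotient.idealrBE; split=> [/eqP|/eqP]. Qed.

Lemma projD f g : proj (f + g) = proj f + proj g.
Proof. exact: (Quotient.pi_add (@assosym_ideal K X)). Qed.

Lemma proj_surj (x : F) : proj (repr x) = x.
Proof. exact: reprK. Qed.

Definition freeAssosym_scale (c : K) (x : F) : F := proj (c *: repr x).

Lemma projZ c f : proj (c *: f) = freeAssosym_scale c (proj f).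
Proof.
by apply/projP; rewrite -scalerBr; apply: assosym_idealZ; apply/projP; rewrite proj_surj.
Qed.

Lemma freeAssosym_scaleA c d x :
  freeAssosym_scale c (freeAssosym_scale d x) = freeAssosym_scale (c * d) x.
Proof. by rewrite -(proj_surj x) -!projZ scalerA. Qed.

Lemma freeAssosym_scale1 : left_id 1 freeAssosym_scale.
Proof. by move=> x; rewrite -(proj_surj x) -!projZ scale1r. Qed.

Lemma freeAssosym_scaleDr : right_distributive freeAssosym_scale +%R.
Proof.
move=> c x y; rewrite -(proj_surj x) -(proj_surj y).
by rewrite -projD -!projZ scalerDr projD.
Qed.

Lemma freeAssosym_scaleDl x :
  {morph freeAssosym_scale^~ x : c d / c + d}.
Proof. by move=> c d; rewrite -(proj_surj x) -!projZ scalerDl projD. Qed.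

HB.instance Definition _ := GRing.Zmodule_isLmodule.Build K F
  freeAssosym_scaleA freeAssosym_scale1 freeAssosym_scaleDr freeAssosym_scaleDl.

Definition freeAssosym_mul (x y : F) : F := proj (amul (repr x) (repr y)).

Lemma projM f g : proj (amul f g) = freeAssosym_mul (proj f) (proj g).
Proof.
apply: (@etrans _ _ (proj (amul (repr (proj f)) g))); apply/projP.
  by rewrite -amulBl; apply: assosym_idealMl; apply/projP; rewrite proj_surj.
by rewrite -amulBr; apply: assosym_idealMr; apply/projP; rewrite proj_surj.
Qed.

Lemma freeAssosym_mulDl x y z :
  freeAssosym_mul (x + y) z = freeAssosym_mul x z + freeAssosym_mul y z.
Proof.
rewrite -(proj_surj x) -(proj_surj y) -(proj_surj z).
by rewrite -projD -!projM amulDl projD.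
Qed.

Lemma freeAssosym_mulDr x y z :
  freeAssosym_mul x (y + z) = freeAssosym_mul x y + freeAssosym_mul x z.
Proof.
rewrite -(proj_surj x) -(proj_surj y) -(proj_surj z).
by rewrite -projD -!projM amulDr projD.
Qed.

Lemma freeAssosym_mulZl (c : K) x y :
  freeAssosym_mul (c *: x) y = c *: freeAssosym_mul x y.
Proof.
rewrite -(proj_surj x) -(proj_surj y) -[c *: proj _]projZ.
by rewrite -!projM amulZl projZ.
Qed.

Lemma freeAssosym_mulZr (c : K) x y :
  freeAssosym_mul x (c *: y) = c *: freeAssosym_mul x y.
Proof.
rewrite -(proj_surj x) -(proj_surj y) -[c *: proj _]projZ.
by rewrite -!projM amulZr projZ.
Qed.

HB.instance Definition _ := Lmodule_isNAAlgebra.Build K F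
  freeAssosym_mulDl freeAssosym_mulDr freeAssosym_mulZl freeAssosym_mulZr.

Definition generator (x : X) : F := proj << Letter x >>.

Definition monomial (w : word X) : F := word_eval generator w.

End FreeAssosym.

Section Dimension.
Variables (K : fieldType) (V : lmodType K).

Definition span (S : V -> Prop) (v : V) : Prop :=
  exists m : nat, exists2 e : 'I_m -> V, (forall i, S (e i)) &
  exists c : 'I_m -> K, v = \sum_i c i *: e i.

(* MathComp's \dim needs a finite-dimensional ambient space, which F(r) is
   not. *)
Definition has_dim (W : V -> Prop) (d : nat) : Prop :=
  exists b : 'I_d -> V,
    (forall c : 'I_d -> K, \sum_i c i *: b i = 0 -> forall i, c i = 0) /\
    (forall v, W v <-> exists c : 'I_d -> K, v = \sum_i c i *: b i).

End Dimension.

Section HomogeneousComponents.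
Variables (K : fieldType) (r : nat).
Local Notation F := (freeAssosym K 'I_r).

Definition F_multideg (l : 'I_r -> nat) : F -> Prop :=
  span (fun v => exists2 w : word 'I_r,
    (forall i, count_mem i (letters w) = l i) & v = monomial K w).

Definition F_deg (n : nat) : F -> Prop :=
  span (fun v => exists2 w : word 'I_r,
    size (letters w) = n & v = monomial K w).

End HomogeneousComponents.

Definition F_multi (K : fieldType) (n : nat) : freeAssosym K 'I_n -> Prop :=
  F_multideg (fun _ => 1%N).

Definition multinomial (r : nat) (l : 'I_r -> nat) : nat :=
  ((\sum_i l i)`! %/ \prod_i (l i)`!)%N.

(* Binomial coefficients with negative lower index are zero. In the dimension
   formulas with n, r >= 1 a negative upper index (n + r - 3 for n = r = 1)
   occurs only together with a negative lower one. *)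
Definition binz (m k : int) : int :=
  match m, k with
  | Posz m', Posz k' => 'C(m', k')%:Z
  | _, _ => 0
  end.

(* Main.v *)
(* In an assosymmetric algebra (characteristic not 2, 3) the associator
   s(a, b, c) satisfies s(ab, c, d) = a s(b, c, d) + s(a, c, d) b, the
   commutator [a, s(b, c, d)] is symmetric in its four arguments, and on the
   ideal D generated by the associators all left and right multiplications
   commute and factor through commutative quotients. Hence the part of D of a
   given multidegree is spanned by the elements
     a_{i1} (... (a_{ik} [a_{jm}, ... [a_{j4}, s(a_{j1}, a_{j2}, a_{j3})]])),
   which are symmetric in the i's and in the j's, and modulo D a monomial is
   determined by its underlying word. So the dimension is at most the number of
   words plus the number of pairs of multisets (I, J) with |J| >= 3.
   These elements are independent: words are separated by the free associative
   algebra, and the elements of D by an assosymmetric product on R^3, for R a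
   polynomial ring in 2r commuting variables, which sends the element (I, J)
   above to the monomial prod_{i in I} y_i prod_{j in J} z_j. *)
From HB Require Import structures.
Require Import Defs.
From mathcomp Require Import all_boot all_algebra.
From mathcomp Require Import boolp finmap.
From mathcomp.multinomials Require Import monalg.
From mathcomp Require Import ring zify.

Set Implicit Arguments.
Unset Strict Implicit.
Unset Printing Implicit Defensive.

Import GRing.Theory.
Local Open Scope ring_scope.

Local Notation span := Defs.span.

(* The embedding of [V] in its square-zero extension [int * V] lets the [ring]
   tactic decide identities between integral combinations in [V]. *)
Definition trivext (V : zmodType) : Type := (int * V)%type.

HB.instance Definition _ V := GRing.Zmodule.on (trivext V).

Section TrivialExtension.
Variable V : zmodType.
Implicit Types x y z : trivext V.

Definition trivext_one : trivext V := (1, 0).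
Definition trivext_mul x y : trivext V := (x.1 * y.1, y.2 *~ x.1 + x.2 *~ y.1).

Lemma trivext_mulA : associative trivext_mul.
Proof.
move=> x y z; rewrite /trivext_mul /= mulrA; congr pair.
by rewrite !mulrzDl -!mulrzA addrA [z.1 * _]mulrC [x.1 * y.1]mulrC.
Qed.

Lemma trivext_mulC : commutative trivext_mul.
Proof. by move=> x y; rewrite /trivext_mul mulrC addrC. Qed.

Lemma trivext_mul1 : left_id trivext_one trivext_mul.
Proof. by case=> m v; rewrite /trivext_mul /= mul1r mul0rz addr0. Qed.

Lemma trivext_mulDl : left_distributive trivext_mul +%R.
Proof.
move=> x y z; rewrite /trivext_mul /= mulrDl mulrzDl mulrzDr.
by congr pair; rewrite addrACA.
Qed.

Lemma trivext_one_neq0 : trivext_one != 0.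
Proof. by []. Qed.

HB.instance Definition _ := GRing.Zmodule_isComNzRing.Build (trivext V)
  trivext_mulA trivext_mulC trivext_mul1 trivext_mulDl trivext_one_neq0.

Definition trivext_inr (v : V) : trivext V := (0, v).

Lemma trivext_inr_additive : zmod_morphism trivext_inr.
Proof. by move=> u v; rewrite /trivext_inr; congr pair; rewrite subr0. Qed.

HB.instance Definition _ :=
  GRing.isZmodMorphism.Build V (trivext V) trivext_inr trivext_inr_additive.

Lemma trivext_inr_inj : injective trivext_inr.
Proof. by move=> u v []. Qed.

End TrivialExtension.

Ltac abel := apply: trivext_inr_inj; ring.


Lemma eqD (V : zmodType) (x y z t : V) : x = y -> z = t -> x + z = y + t.
Proof. by move=> -> ->. Qed.

Lemma eqB (V : zmodType) (x y z t : V) : x = y -> z = t -> x - z = y - t.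
Proof. by move=> -> ->. Qed.

(** Reduces [x = y] to an identity between formal combinations once a relation [z = t] is known;
    [abel_from] thus decides equality modulo one linear relation. *)
Lemma eq_by_diff (V : zmodType) (x y z t : V) : z = t -> x - y = z - t -> x = y.
Proof. by move=> -> /eqP; rewrite subrr subr_eq0 => /eqP. Qed.

Ltac abel_from h := apply: (eq_by_diff h); abel.

(** * Identities of assosymmetric algebras *)

Section AssosymmetricIdentities.
Variables (K : fieldType) (E : naAlgType K).
Local Notation "x ** y" := (amul x y) (at level 40, left associativity).
Local Notation s := (@associator K E).
Local Notation comm x y := (x ** y - y ** x).
Implicit Types a b c d e x y z : E.

Lemma associatorE a b c : s a b c = a ** b ** c - a ** (b ** c).
Proof. by rewrite associator.unlock. Qed.

Lemma associatorDl a b c d : s (a + b) c d = s a c d + s b c d.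
Proof. by rewrite !associatorE !amulDl; abel. Qed.

Lemma associatorBl a b c d : s (a - b) c d = s a c d - s b c d.
Proof. by rewrite !associatorE !amulBl; abel. Qed.

Lemma associatorZl (k : K) a b c : s (k *: a) b c = k *: s a b c.
Proof. by rewrite !associatorE !amulZl scalerBr. Qed.

(** Holds in every algebra, without any symmetry of the associator. *)
Lemma teichmuller a b c d :
  s (a ** b) c d - s a (b ** c) d + s a b (c ** d)
  = a ** s b c d + s a b c ** d.
Proof. by rewrite !associatorE amulBl amulBr; abel. Qed.

Lemma comm_mull a b c :
  s a b c - s a c b + s c a b
  = comm (a ** b) c - a ** comm b c - comm a c ** b.
Proof. by rewrite !associatorE !(amulBl, amulBr); abel. Qed.

Hypotheses (char_neq2 : 2%N \notin [pchar K]) (char_neq3 : 3%N \notin [pchar K]).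
Hypothesis Eas : assosymmetric E.

Lemma mulr2n_inj x y : x *+ 2 = y *+ 2 -> x = y.
Proof.
move=> /eqP; rewrite -subr_eq0 -mulrnBl -scaler_nat scaler_eq0 subr_eq0.
by case/orP=> /eqP // h2; case/negP: char_neq2; rewrite inE h2 eqxx.
Qed.

Lemma mulr3n_eq0 x : x *+ 3 = 0 -> x = 0.
Proof.
move=> /eqP; rewrite -scaler_nat scaler_eq0.
by case/orP=> /eqP // h3; case/negP: char_neq3; rewrite inE h3 eqxx.
Qed.

Lemma sC23 a b c : s a b c = s a c b.
Proof. by case: (Eas a b c). Qed.

Lemma sC12 a b c : s a b c = s b a c.
Proof. by case: (Eas a b c). Qed.

Lemma sC13 a b c : s a b c = s c b a.
Proof. by rewrite sC12 sC23 sC12. Qed.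

Lemma srot a b c : s a b c = s b c a.
Proof. by rewrite sC12 sC23. Qed.

(* By the Teichmuller identity [q a b c d] depends only on the partition
   {{a, b}, {c, d}}, and each of its three values is twice the next one. *)
Let q a b c d := s (a ** b) c d - b ** s a c d - s b c d ** a.
Let N a b c d := a ** s b c d - s b c d ** a.

(** Bundled as a multi-rule, so that one rewrite brings every ordering of three given arguments to
    the order [x], [y], [z]. *)
Lemma associator_perm x y z :
  ((s x z y = s x y z) * (s y x z = s x y z) * (s y z x = s x y z) *
   (s z x y = s x y z) * (s z y x = s x y z))%type.
Proof.
split; last exact: sC13; split; last exact: srot; split; last by rewrite -srot.
by split; [exact: sC23 | exact: sC12].
Qed.

Let teich a b c d :
  s (a ** b) c d - s (b ** c) a d + s (c ** d) a b
  = a ** s b c d + s a b c ** d.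
Proof. by rewrite (sC12 (b ** c)) (srot (c ** d)) -teichmuller. Qed.

Let q_swap a b c d : q a b c d = q a b d c.
Proof. by rewrite /q (sC23 _ c) (sC23 a) (sC23 b). Qed.

Let q_opp a b c d : q b c a d = q d a b c.
Proof.
(* The identities at [(a, b, c, d)] and [(c, d, a, b)] share the terms in [a ** b] and [c ** d], so
   only those in [b ** c] and [d ** a] survive in the difference. *)
have := eqB (teich a b c d) (teich c d a b); rewrite /q.
rewrite !(associator_perm a b c, associator_perm a b d).
rewrite !(associator_perm a c d, associator_perm b c d).
by rewrite !(associator_perm (d ** a) b c) => h; abel_from (esym h).
Qed.

Let qC a b c d : q a b c d = q b a c d.
Proof. by rewrite q_opp q_swap -q_opp. Qed.

Let q_double a b c d :
  q a b c d *+ 2 - q b c a d = N a b c d - N b a c d + N c a b d - N d a b c.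
Proof.
rewrite mulr2n -{2}(q_opp b); have := teich a b c d; rewrite /q /N.
rewrite !(associator_perm a b c, associator_perm a b d).
rewrite !(associator_perm a c d, associator_perm b c d).
by rewrite !(associator_perm (c ** d) a b) => h; abel_from h.
Qed.

Let N_perm a b c d :
 ((N a b d c = N a b c d) * (N a c b d = N a b c d) * (N a c d b = N a b c d) *
   (N a d b c = N a b c d) * (N a d c b = N a b c d))%type.
Proof. by do !split; rewrite /N !(associator_perm b c d). Qed.

Let q_next a b c d : q a b c d *+ 2 = q b c a d.
Proof.
(* The right-hand sides of [h1] and [h2] are opposite, so their sum is twice the claim. *)
have h1 := q_double a b c d; have h2 := q_double b a d c.
apply: mulr2n_inj; move: (eqD h1 h2).
rewrite (qC b a) (q_swap a b d) (qC a d) -(q_opp a b c d) !(N_perm a b c d).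
rewrite !(N_perm b a c d) !(N_perm c a b d) !(N_perm d a b c) => h.
by abel_from h.
Qed.

Let q_eq0 a b c d : q a b c d = 0.
Proof.
(* Doubling twice leads back to the partition {{a, b}, {c, d}}, so [q] equals four times itself. *)
apply: mulr3n_eq0; have h1 := q_next a b c d; have h2 := q_next b c d a.
move: h2; rewrite q_swap -h1 -(q_opp b) => h2.
by abel_from h2.
Qed.

Lemma associator_mul a b c d :
  s (a ** b) c d = b ** s a c d + s b c d ** a.
Proof. by have := q_eq0 a b c d; rewrite /q => h; abel_from h. Qed.

Lemma comm_associator a b c d :
  a ** s b c d - s b c d ** a = d ** s a b c - s a b c ** d.
Proof.
rewrite -/(N a b c d) -/(N d a b c); apply: mulr2n_inj.
(* Now that [q] vanishes, each instance is an alternating sum of four [N] equal to zero. In the sum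
   of the two, the terms starting with [b] and [c] cancel. *)
have h1 := q_double a b c d; have h2 := q_double a c b d.
move: (eqD h1 h2); rewrite !q_eq0 !(N_perm a b c d, N_perm d a b c).
by move=> h; abel_from (esym h).
Qed.

Lemma associator_mul2 a b c d :
  s (a ** b) c d = a ** s b c d + s a c d ** b.
Proof.
have := comm_associator a c d b; rewrite associator_mul (associator_perm b c d).
by move=> h; abel_from (esym h).
Qed.

(** The product rule [associator_mul2] is applied to both products that make up [s a b c]. *)
Lemma associator_associator_sum a b c d e :
  s (s a b c) d e
  = s a b (s c d e) + s a c (s b d e) + s b c (s a d e).
Proof.
rewrite [s a b c]associatorE associatorBl !associator_mul2.
rewrite (sC23 a c) -(srot _ b c) !(amulDl, amulDr).
by rewrite [s a b _]associatorE [s a _ c]associatorE [s _ b c]associatorE; abel.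
Qed.

(** The two product rules give the same value on [a ** b] and on [b ** a]. *)
Lemma associator_comml a b c d : s (comm a b) c d = 0.
Proof.
by rewrite associatorBl associator_mul associator_mul2 subrr.
Qed.

Lemma comm_associatorC a b c d e :
  comm a b ** s c d e = s c d e ** comm a b.
Proof.
have := comm_associator (comm a b) c d e.
by rewrite associator_comml amul0l amul0r subrr => /eqP; rewrite subr_eq0 => /eqP.
Qed.

Lemma associator_comm_sum a b c d e :
  s a b (s c d e) + s a c (s b d e) + s b c (s a d e)
  = comm c a ** s b d e + s a d e ** comm c b.
Proof.
(* By [comm_associator], the commutators of [a ** b], [a] and [b] with [s c d e] become commutators
   of [c] with [s (a ** b) d e], [s a d e] and [s b d e]. The product rule expands the first of
   these, and what remains is reassociation. *)
have hl := comm_mull a b (s c d e).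
have := comm_associator (a ** b) d e c.
have ha := comm_associator a d e c; have hb := comm_associator b d e c.
rewrite !(associator_perm c d e) in ha hb *; rewrite associator_mul2 => hr.
move: hl; rewrite {}ha {}hb {}hr !(associator_perm a b (s c d e)).
rewrite (sC23 a c) -(srot _ b c).
rewrite [s a b _]associatorE [s a _ c]associatorE [s _ b c]associatorE.
rewrite !(amulDl, amulDr, amulBl, amulBr) => h.
have := eqD (sC23 (s a d e) c b) (esym (srot c (s a d e) b)).
move/eqB/(_ (sC12 c a (s b d e))).
move: (s a d e) (s b d e) (s c d e) h => u v w h; rewrite !associatorE => h'.
abel_from (eqD h h').
Qed.

Lemma associator_associator_eq0 a b c d e : s (s a b c) d e = 0.
Proof.
have h x y z : s (s x y z) d e = comm z x ** s y d e + comm z y ** s x d e.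
  by rewrite associator_associator_sum associator_comm_sum -comm_associatorC.
(* By symmetry of [s a b c], three times the left side is the sum of [h] over the cyclic rotations
   of [a], [b], [c], where the commutators cancel in pairs. *)
apply: mulr3n_eq0; rewrite mulrSr mulr2n {2}(srot a) -{2}(srot c).
by rewrite !h !amulBl; abel.
Qed.

(* [comm a b ** s c d e] is alternating in [a], [b], [c] and symmetric in [c],
   [d], [e], which kills it. *)
Lemma comm_mul_cycle a b c d e :
  comm c a ** s b d e = comm b c ** s a d e.
Proof.
have := associator_comm_sum a b c d e; rewrite -comm_associatorC.
do 3![rewrite -(srot (s _ _ _)) associator_associator_eq0]; rewrite !addr0.
by rewrite !amulBl => h; abel_from (esym h).
Qed.

Lemma comm_mul_associator a b c d e : comm a b ** s c d e = 0.
Proof.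
have swap x y z t u : comm x y ** s z t u = - (comm z y ** s x t u).
  by rewrite (comm_mul_cycle y z x) (comm_mul_cycle x y z) !amulBl opprB.
apply: mulr2n_inj; rewrite mul0rn mulr2n {2}(swap a b).
rewrite (sC12 a d) (swap c b d) opprK.
by rewrite (sC12 c d) (swap a b d) (sC12 a c) addNr.
Qed.

Lemma associator_mul_comm a b c d e : s c d e ** comm a b = 0.
Proof. by rewrite -comm_associatorC comm_mul_associator. Qed.

Lemma associator_mul_associator a b c x y z : s a b c ** s x y z = 0.
Proof.
have mulA u v : u ** v ** s x y z = u ** (v ** s x y z).
  apply/eqP; rewrite -subr_eq0 -associatorE.
  by rewrite -(srot (s x y z)) associator_associator_eq0.
have mulC u v : u ** v ** s x y z = v ** u ** s x y z.
  by apply/eqP; rewrite -subr_eq0 -amulBl comm_mul_associator.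
(* By symmetry the left side of [comm_mull] is the single associator [s a b c], which is thereby a
   combination of commutators and their multiples. [mulA] and [mulC] bring each commutator next to
   [s x y z], which it annihilates. *)
have := comm_mull a b c; rewrite !(associator_perm a b c) subrr add0r => ->.
rewrite 2!amulBl (mulA a) (mulC (comm a c)) (mulA b) !comm_mul_associator.
by rewrite !amul0r !subrr.
Qed.

Inductive associator_ideal : E -> Prop :=
| associator_ideal_gen a b c : associator_ideal (s a b c)
| associator_ideal_mull a d : associator_ideal d -> associator_ideal (a ** d)
| associator_ideal_mulr a d : associator_ideal d -> associator_ideal (d ** a)
| associator_ideal_lin (k : K) d d' :
    associator_ideal d -> associator_ideal d' -> associator_ideal (k *: d + d').

(** The properties are proved by one joint induction: the product rule turns [s a b (x ** d)] into a
    multiple of [s a b d] plus a product of [d] with an associator, and the commutator claims for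
    [x ** d] in turn rest on [s a b d = 0]. *)
Lemma associator_ideal_ann d : associator_ideal d -> forall a b,
  [/\ s a b d = 0, comm a b ** d = 0, d ** comm a b = 0 &
      forall c, s a b c ** d = 0 /\ d ** s a b c = 0].
Proof.
elim=> {d} [x y z|x d _ IHd|x d _ IHd|k d d' _ IHd _ IHd'] a b.
- split; rewrite ?comm_mul_associator ?associator_mul_comm //.
    by rewrite -srot associator_associator_eq0.
  by move=> c; rewrite !associator_mul_associator.
- have mulA u v : u ** v ** d = u ** (v ** d).
    by case: (IHd u v) => /eqP; rewrite associatorE subr_eq0 => /eqP.
  have mulC u v : u ** v ** d = v ** u ** d.
    by case: (IHd u v) => _ /eqP; rewrite amulBl subr_eq0 => /eqP.
  have mulAA u v : u ** d ** v = u ** (d ** v).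
    case: (IHd u v) => /eqP; rewrite (sC23 u) => h _ _ _.
    by apply/eqP; rewrite -subr_eq0 -associatorE.
  have [h1 h2 h3 _] := IHd a b; split.
  + rewrite -srot associator_mul2 (srot d) h1 amul0r add0r (srot x).
    by have [_ _ _ /(_ x) []] := IHd a b.
  + by rewrite -mulA mulC mulA h2 amul0r.
  + by rewrite mulAA h3 amul0r.
  + move=> c; have [_ _ _ /(_ c) [h4 h5]] := IHd a b; split.
      by rewrite -mulA mulC mulA h4 amul0r.
    by rewrite mulAA h5 amul0r.
- have mulA u v : d ** u ** v = d ** (u ** v).
    case: (IHd u v) => /eqP; rewrite srot srot => h _ _ _.
    by apply/eqP; rewrite -subr_eq0 -associatorE.
  have mulC u v : d ** (u ** v) = d ** (v ** u).
    by case: (IHd u v) => _ _ /eqP; rewrite amulBr subr_eq0 => /eqP.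
  have mulAA u v : u ** d ** v = u ** (d ** v).
    case: (IHd u v) => /eqP; rewrite (sC23 u) => h _ _ _.
    by apply/eqP; rewrite -subr_eq0 -associatorE.
  have [h1 h2 h3 _] := IHd a b; split.
  + rewrite -srot associator_mul2 (srot d) h1 amul0l addr0 (srot x).
    by have [_ _ _ /(_ x) []] := IHd a b.
  + by rewrite -mulAA h2 amul0l.
  + by rewrite mulA mulC -mulA h3 amul0l.
  + move=> c; have [_ _ _ /(_ c) [h4 h5]] := IHd a b; split.
      by rewrite -mulAA h4 amul0l.
    by rewrite mulA mulC -mulA h5 amul0l.
- have [h1 h2 h3 h4] := IHd a b; have [h1' h2' h3' h4'] := IHd' a b; split.
  + rewrite -srot associatorDl associatorZl (srot d) (srot d') h1 h1'.
    by rewrite scaler0 addr0.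
  + by rewrite amulDr amulZr h2 h2' scaler0 addr0.
  + by rewrite amulDl amulZl h3 h3' scaler0 addr0.
  + move=> c; have [[h5 h6] [h5' h6']] := (h4 c, h4' c).
    rewrite amulDr amulDl amulZl amulZr h5 h6 h5' h6'.
    by rewrite scaler0 addr0.
Qed.

Lemma ideal_mulA a b d : associator_ideal d -> a ** b ** d = a ** (b ** d).
Proof.
case/associator_ideal_ann/(_ a b) => /eqP.
by rewrite associatorE subr_eq0 => /eqP.
Qed.

Lemma ideal_mulCA a b d : associator_ideal d -> a ** (b ** d) = b ** (a ** d).
Proof.
move=> Id; rewrite -!ideal_mulA //; case/associator_ideal_ann/(_ a b): Id.
by move=> _ /eqP; rewrite amulBl subr_eq0 => /eqP.
Qed.

Lemma ideal_mulAr a b d : associator_ideal d -> d ** (a ** b) = d ** a ** b.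
Proof.
case/associator_ideal_ann/(_ a b) => /eqP; rewrite -srot associatorE subr_eq0.
by move=> /eqP.
Qed.

Lemma ideal_mulAC a b d : associator_ideal d -> d ** a ** b = d ** b ** a.
Proof.
move=> Id; rewrite -!ideal_mulAr //; case/associator_ideal_ann/(_ a b): Id.
by move=> _ _ /eqP; rewrite amulBr subr_eq0 => /eqP.
Qed.

Lemma ideal_mulAlr a b d : associator_ideal d -> a ** d ** b = a ** (d ** b).
Proof.
case/associator_ideal_ann/(_ a b) => /eqP.
by rewrite (sC23 a) associatorE subr_eq0 => /eqP.
Qed.

End AssosymmetricIdentities.

(** * Spanning set *)

(** Adjacent transpositions generate all permutations; [fbubble] carries one letter to the front,
    behind an arbitrary fixed prefix. *)
Lemma perm_eq_adjacent (T : eqType) (R : Type) (f : seq T -> R) :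
  (forall p x y q, f (p ++ x :: y :: q) = f (p ++ y :: x :: q)) ->
  forall s t, perm_eq s t -> f s = f t.
Proof.
move=> fswap; have fbubble x t1 t2 p : f (p ++ t1 ++ x :: t2) = f (p ++ x :: t1 ++ t2).
  elim: t1 p => //= y t1 IH p; rewrite -fswap.
  by have := IH (rcons p y); rewrite !cat_rcons.
move=> s t; rewrite -[s]cat0s -[t]cat0s perm_cat2l.
elim: s t [::] => [|x s IH] t p; first by rewrite perm_sym => /perm_nilP ->.
move=> st; have xt: x \in t by rewrite -(perm_mem st) mem_head.
case/splitPr: xt st => t1 t2 st; rewrite fbubble -!(cat_rcons x).
by apply: IH; rewrite -(perm_cons x) (permPl st) perm_catC /= perm_cons perm_catC.
Qed.

Section Span.
Variables (K : fieldType) (V : lmodType K) (S : V -> Prop).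

Lemma span_gen v : S v -> span S v.
Proof.
move=> Sv; exists 1%N, (fun=> v) => //; exists (fun=> 1).
by rewrite big_ord1 scale1r.
Qed.

Lemma span0 : span S 0.
Proof.
by exists 0%N, (fun=> 0); [case | exists (fun=> 0); rewrite big_ord0].
Qed.

Lemma span_lin k u v : span S u -> span S v -> span S (k *: u + v).
Proof.
case=> m [e eS [c ->]] [n [e' e'S [c' ->]]].
exists (m + n)%N, (fun i => match split i with inl j => e j | inr j => e' j end).
  by move=> i; case: (split i).
exists (fun i => match split i with inl j => k * c j | inr j => c' j end).
rewrite big_split_ord scaler_sumr; congr (_ + _); apply: eq_bigr => i _.
  by rewrite (unsplitK (inl i)) scalerA.
by rewrite (unsplitK (inr i)).
Qed.

Lemma span_elim (P : V -> Prop) :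
  P 0 -> (forall k u v, P u -> P v -> P (k *: u + v)) -> (forall v, S v -> P v) ->
  forall v, span S v -> P v.
Proof.
move=> P0 Plin PS _ [m [e eS [c ->]]].
by elim/big_ind: _ => // [u v Pu Pv|i _]; rewrite ?[c i *: _]addr0;
   [rewrite -[u]scale1r; apply: Plin | rewrite -[X in P X]addr0; apply: Plin; [exact: PS|]].
Qed.

Lemma spanD u v : span S u -> span S v -> span S (u + v).
Proof. by move=> Su; rewrite -[u]scale1r; apply: span_lin. Qed.

Lemma spanZ k u : span S u -> span S (k *: u).
Proof. by move=> Su; rewrite -[_ *: u]addr0; apply/span_lin/span0. Qed.

Lemma spanB u v : span S u -> span S v -> span S (u - v).
Proof. by move=> Su Sv; rewrite -scaleN1r; apply/spanD/spanZ. Qed.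

End Span.

Lemma span_linear (K : fieldType) (V W : lmodType K) (S : V -> Prop) (S' : W -> Prop)
    (f : V -> W) : (forall k u v, f (k *: u + v) = k *: f u + f v) ->
  (forall v, S v -> span S' (f v)) -> forall v, span S v -> span S' (f v).
Proof.
move=> flin fS; apply: span_elim => [|k u v Su Sv|//].
  have := flin (-1) 0 0; rewrite scaler0 addr0 scaleN1r addNr => ->; exact: span0.
by rewrite flin; apply: span_lin.
Qed.

Section Words.
Variables (K : fieldType) (E : naAlgType K) (X : eqType) (g : X -> E).
Hypotheses (char_neq2 : 2%N \notin [pchar K]) (char_neq3 : 3%N \notin [pchar K]).
Hypothesis Eas : assosymmetric E.
Local Notation "x ** y" := (amul x y) (at level 40, left associativity).
Local Notation s := (@associator K E).
Local Notation I := (@associator_ideal K E).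
Implicit Types (l t u : seq X) (v : E).

Definition gen_mul x v : E := g x ** v.
Definition gen_comm x v : E := g x ** v - v ** g x.

(** The iterated commutator around one associator, with the last letter outermost. Lists with fewer
    than three letters get the default 0, whence the condition [3 <= size t] further on. *)
Definition sym_associator t : E :=
  if t is x :: y :: z :: t' then
    foldl (fun v x => gen_comm x v) (s (g x) (g y) (g z)) t'
  else 0.

Definition tail_monomial u t : E := foldr gen_mul (sym_associator t) u.

Lemma ideal_gen_mul x v : I v -> I (gen_mul x v).
Proof. exact: associator_ideal_mull. Qed.

Lemma ideal_gen_comm x v : I v -> I (gen_comm x v).
Proof.
move=> Iv; rewrite /gen_comm addrC -scaleN1r; apply: associator_ideal_lin.
  exact: associator_ideal_mulr.
exact: associator_ideal_mull.
Qed.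

Lemma ideal_sym_associator t : I (sym_associator t).
Proof.
have I0 : I 0.
  by have := associator_ideal_gen (0 : E) 0 0; rewrite associatorE !amul0l subrr.
case: t => [|x [|y [|z t]]] //=.
have: I (s (g x) (g y) (g z)) by exact: associator_ideal_gen.
by elim: t (s _ _ _) => //= a t IH v Iv; apply/IH/ideal_gen_comm.
Qed.

Lemma ideal_tail_monomial u t : I (tail_monomial u t).
Proof.
by elim: u => [|x u IH] /=; [exact: ideal_sym_associator | exact: ideal_gen_mul].
Qed.

Lemma gen_mulC x y v : I v -> gen_mul x (gen_mul y v) = gen_mul y (gen_mul x v).
Proof. exact: ideal_mulCA. Qed.

Lemma gen_comm_mul x y v :
  I v -> gen_comm x (gen_mul y v) = gen_mul y (gen_comm x v).
Proof.
move=> Iv; rewrite /gen_comm /gen_mul amulBr; congr (_ - _).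
  exact: ideal_mulCA.
exact: ideal_mulAlr.
Qed.

Lemma gen_commC x y v :
  I v -> gen_comm x (gen_comm y v) = gen_comm y (gen_comm x v).
Proof.
move=> Iv; rewrite /gen_comm !(amulBl, amulBr).
have [c2 c3] := (char_neq2, char_neq3).
rewrite (ideal_mulCA c2 c3 Eas (g x) (g y) Iv).
rewrite (ideal_mulAC c2 c3 Eas (g y) (g x) Iv).
rewrite (ideal_mulAlr c2 c3 Eas (g x) (g y) Iv).
by rewrite (ideal_mulAlr c2 c3 Eas (g y) (g x) Iv); abel.
Qed.

Lemma sym_associator_perm t t' :
  perm_eq t t' -> sym_associator t = sym_associator t'.
Proof.
(* The length of the prefix tells where the swapped pair lies: inside the associator, across its
   third argument and the first commutator (this is [comm_associator]), or among the commutators. *)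
apply: perm_eq_adjacent => {t t'} [[|x [|y [|z p]]]] a b q /=.
- by case: q => //= c q; rewrite sC12.
- by rewrite sC23.
- congr foldl; rewrite /gen_comm comm_associator //.
  rewrite !(associator_perm Eas (g x) (g y)).
  by have := comm_associator char_neq2 char_neq3 Eas (g b) (g x) (g y) (g a).
- rewrite !foldl_cat /=; congr foldl; apply: gen_commC.
  exact: (@ideal_sym_associator (x :: y :: z :: p)).
Qed.

Lemma tail_monomial_perm u u' t t' :
  perm_eq u u' -> perm_eq t t' -> tail_monomial u t = tail_monomial u' t'.
Proof.
move=> uu /sym_associator_perm tt; rewrite /tail_monomial -tt.
apply: perm_eq_adjacent uu => p x y q; rewrite !foldr_cat /= gen_mulC //.
exact: (@ideal_tail_monomial q t).
Qed.

Definition tail_span l : E -> Prop := span (fun v =>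
  exists u t, [/\ (3 <= size t)%N, perm_eq (u ++ t) l & v = tail_monomial u t]).

Lemma tail_span_perm l l' v : perm_eq l l' -> tail_span l v -> tail_span l' v.
Proof.
move=> ll; apply: span_elim; [exact: span0 | by move=> *; apply: span_lin |].
move=> _ [u [t [t3 ut ->]]]; apply: span_gen; exists u, t; split=> //.
exact: perm_trans ll.
Qed.

Lemma ideal_tail_span l v : tail_span l v -> I v.
Proof.
have I0 := @ideal_sym_associator [::].
apply: span_elim => // [k x y Ix Iy|_ [u [t [_ _ ->]]]].
  exact: associator_ideal_lin.
exact: ideal_tail_monomial.
Qed.

Lemma gen_comm_sym_associator x t :
  (3 <= size t)%N -> gen_comm x (sym_associator t) = sym_associator (rcons t x).
Proof. by case: t => [|a [|b [|c t]]] //= _; rewrite foldl_rcons. Qed.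

(** On the ideal, commutators commute with left multiplications, so the new commutator slides down
    to the symmetric core. *)
Lemma gen_comm_tail_monomial x u t : (3 <= size t)%N ->
  gen_comm x (tail_monomial u t) = tail_monomial u (rcons t x).
Proof.
move=> t3; elim: u => [|y u IH] /=; first exact: gen_comm_sym_associator.
by rewrite gen_comm_mul ?IH //; apply: ideal_tail_monomial.
Qed.

Lemma tail_span_gen_mull x l v : tail_span l v -> tail_span (x :: l) (g x ** v).
Proof.
apply: (span_linear (f := amul (g x))) => [k a b|_ [u [t [t3 ut ->]]]].
  by rewrite amulDr amulZr.
by apply: span_gen; exists (x :: u), t; rewrite /= perm_cons.
Qed.

Lemma tail_span_gen_mulr x l v : tail_span l v -> tail_span (x :: l) (v ** g x).
Proof.
(* Right multiplication is left multiplication minus a commutator, and each of these sends tail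
   monomials to tail monomials. *)
move=> lv; have -> : v ** g x = g x ** v - gen_comm x v by rewrite /gen_comm; abel.
apply: spanB; first exact: tail_span_gen_mull.
apply: (span_linear (f := gen_comm x)) lv => [k a b|_ [u [t [t3 ut ->]]]].
  by rewrite /gen_comm !(amulDr, amulDl, amulZr, amulZl) scalerBr; abel.
rewrite gen_comm_tail_monomial //; apply: span_gen; exists u, (rcons t x).
by rewrite size_rcons ltnW // -cats1 catA cats1 perm_rcons perm_cons.
Qed.

Local Notation ev := (word_eval g).

Lemma tail_span_word w l v :
  tail_span l v -> tail_span (letters w ++ l) (ev w ** v) /\
                   tail_span (letters w ++ l) (v ** ev w).
Proof.
elim: w l v => [x|w1 IH1 w2 IH2] l v lv /=.
  by split; [apply: tail_span_gen_mull | apply: tail_span_gen_mulr].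
have Iv := ideal_tail_span lv; have [c2 c3] := (char_neq2, char_neq3).
rewrite -catA (ideal_mulA c2 c3 Eas _ _ Iv) (ideal_mulAr c2 c3 Eas _ _ Iv).
split; first exact: (IH1 _ _ (IH2 _ _ lv).1).1.
by have := (IH2 _ _ (IH1 _ _ lv).2).2; apply: tail_span_perm; rewrite perm_catCA.
Qed.

Lemma tail_span_associator w1 w2 w3 :
  tail_span (letters w1 ++ letters w2 ++ letters w3) (s (ev w1) (ev w2) (ev w3)).
Proof.
(* [gen] reduces the first argument to letters by the product rule; symmetry of the associator then
   brings the two other arguments to the front in turn. *)
have gen w w' :
    (forall x, tail_span (x :: letters w ++ letters w') (s (g x) (ev w) (ev w'))) ->
  forall w0,
    tail_span (letters w0 ++ letters w ++ letters w') (s (ev w0) (ev w) (ev w')).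
  move=> Hx; elim=> [x|w1' IH1 w2' IH2] /=; first exact: Hx.
  rewrite associator_mul2 //; apply: spanD.
    by rewrite -catA; case: (tail_span_word w1' IH2).
  rewrite -catA; have := (tail_span_word w2' IH1).2.
  by apply: tail_span_perm; rewrite perm_catCA.
apply: (gen) => x; rewrite sC12 //.
apply: (@tail_span_perm (letters w2 ++ x :: letters w3)).
  by rewrite -cat1s perm_catCA.
apply: (gen (Letter x)) => y /=; rewrite -srot //.
apply: (@tail_span_perm (letters w3 ++ [:: y; x])); first by rewrite perm_catC.
apply: (gen (Letter y) (Letter x)) => z /=.
by apply: span_gen; exists [::], [:: z; y; x].
Qed.

(** The right-normed bracketing; the first letter is a separate argument because words are
    nonempty. *)
Fixpoint rnorm x t : word X :=
  if t is y :: t' then Node (Letter x) (rnorm y t') else Letter x.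

Lemma letters_rnorm x t : letters (rnorm x t) = x :: t.
Proof. by elim: t x => //= y t IH x; rewrite IH. Qed.

Lemma letters_neq0 (w : word X) : exists x t, letters w = x :: t.
Proof.
by elim: w => [x|w [x [t /= ->]] w' _]; [exists x, [::] | exists x, (t ++ letters w')].
Qed.

(** Each letter moved out of the left factor costs one associator of words, which
    [tail_span_associator] handles. *)
Lemma tail_span_rnorm_cat x t y t' :
  tail_span (x :: t ++ y :: t')
    (ev (rnorm x t) ** ev (rnorm y t') - ev (rnorm x (t ++ y :: t'))).
Proof.
elim: t x => [|z t IH] x /=; first by rewrite subrr; apply: span0.
set a := ev (rnorm z t); set b := ev (rnorm y t').
have -> : g x ** a ** b - g x ** ev (rnorm z (t ++ y :: t'))
    = s (g x) a b + g x ** (a ** b - ev (rnorm z (t ++ y :: t'))).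
  by rewrite associatorE amulBr; abel.
apply: spanD; last exact: tail_span_gen_mull.
have := tail_span_associator (Letter x) (rnorm z t) (rnorm y t').
by rewrite !letters_rnorm.
Qed.

Lemma tail_span_rnorm w x t :
  letters w = x :: t -> tail_span (x :: t) (ev w - ev (rnorm x t)).
Proof.
elim: w x t => [y|w1 IH1 w2 IH2] x t /=.
  by case=> -> <-; rewrite subrr; apply: span0.
have [[y [u lw1]] [z [v lw2]]] := (letters_neq0 w1, letters_neq0 w2).
have {IH1} := tail_span_word w2 (IH1 _ _ lw1).
have {IH2} := tail_span_word (rnorm y u) (IH2 _ _ lw2).
rewrite letters_rnorm lw1 lw2 => -[h1 _] [_ h2] [<- <-].
have {}h2 := tail_span_perm (permEl (perm_catC _ _)) h2.
(* The difference telescopes: normalize the left factor, then the right one, then the product of two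
   right-normed words. *)
have := spanD (spanD h1 h2) (tail_span_rnorm_cat y u z v).
by rewrite amulBl amulBr /=; congr (tail_span _ _); abel.
Qed.

Definition word_span l : E -> Prop :=
  span (fun v => exists2 w, perm_eq (letters w) l & v = ev w).

Lemma word_span_gen_mul x l v :
  word_span l v -> word_span (x :: l) (g x ** v) /\ word_span (x :: l) (v ** g x).
Proof.
move=> lv; split.
  apply: (span_linear (f := amul (g x))) lv => [k a b|_ [w wl ->]].
    by rewrite amulDr amulZr.
  by apply: span_gen; exists (Node (Letter x) w); rewrite //= perm_cons.
apply: (span_linear (f := fun v => v ** g x)) lv => [k a b|_ [w wl ->]].
  by rewrite amulDl amulZl.
apply: span_gen; exists (Node w (Letter x)) => //=.
by rewrite perm_catC perm_cons.
Qed.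

(** Serves the converse inclusion: tail monomials lie in the homogeneous component that they help to
    span. *)
Lemma word_span_tail_monomial u t :
  (3 <= size t)%N -> word_span (u ++ t) (tail_monomial u t).
Proof.
elim: u => [|x u IH] t3 /=; last by case: (word_span_gen_mul x (IH t3)).
case: t t3 => [|x [|y [|z t]]] //= _.
have: word_span [:: x; y; z] (s (g x) (g y) (g z)).
  rewrite associatorE; apply: spanB; apply: span_gen.
    by exists (Node (Node (Letter x) (Letter y)) (Letter z)).
  by exists (Node (Letter x) (Node (Letter y) (Letter z))).
rewrite -[in X in _ -> X]/([:: x; y; z] ++ t).
elim: t [:: x; y; z] (s _ _ _) => [|a t IHt] l v lv /=; first by rewrite cats0.
rewrite -cat_rcons; apply: IHt; have [l1 l2] := word_span_gen_mul a lv.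
have : word_span (a :: l) (gen_comm a v) by apply: spanB.
apply: span_elim => [|k b c|_ [w wl ->]]; [exact: span0 | exact: span_lin |].
by apply: span_gen; exists w; rewrite // perm_sym perm_rcons perm_sym.
Qed.

End Words.

(** * Independence *)

Section FreeAssosymEval.
Variables (K : fieldType) (X : choiceType).
Local Notation F := (freeAssosym K X).

Lemma proj_associator (f g h : freeNA K X) :
  proj (associator f g h) = associator (proj f) (proj g) (proj h).
Proof.
rewrite !associatorE -[in RHS]scaleN1r.
rewrite -scaleN1r projD [proj (-1 *: _)]projZ; congr (_ + _).
  by rewrite !projM.
by congr freeAssosym_scale; rewrite !projM.
Qed.

Lemma freeNA_eval_associator (A : naAlgType K) (a : X -> A) (f g h : freeNA K X) :
  freeNA_eval a (associator f g h)
  = associator (freeNA_eval a f) (freeNA_eval a g) (freeNA_eval a h).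
Proof.
rewrite !associatorE -scaleN1r /freeNA_eval linextD linextZ.
by have := @freeNA_evalM K X A a; rewrite /freeNA_eval => evM; rewrite !evM scaleN1r.
Qed.

Lemma freeAssosym_assosymmetric : assosymmetric F.
Proof.
have sym (f f' : freeNA K X) :
    (forall A : naAlgType K, assosymmetric A -> forall a : X -> A,
       freeNA_eval a f = freeNA_eval a f') -> proj f = proj f'.
  move=> ff'; apply/projP/asboolP => A Aas a.
  by rewrite -scaleN1r /freeNA_eval linextD linextZ scaleN1r; apply/eqP;
     rewrite subr_eq0; apply/eqP/ff'.
move=> x y z; rewrite -(proj_surj x) -(proj_surj y) -(proj_surj z).
rewrite -!proj_associator; split; apply: sym => A Aas a;
  rewrite !freeNA_eval_associator; by [rewrite sC23 | rewrite sC12].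
Qed.

Variables (A : naAlgType K) (Aas : assosymmetric A) (a : X -> A).

Definition freeAssosym_eval (x : F) : A := freeNA_eval a (repr x).

Lemma freeAssosym_eval_proj f : freeAssosym_eval (proj f) = freeNA_eval a f.
Proof.
have /projP/asboolP/(_ A Aas a) := proj_surj (proj f).
rewrite /freeNA_eval -scaleN1r linextD linextZ scaleN1r => /eqP.
by rewrite subr_eq0 => /eqP.
Qed.

Lemma freeAssosym_eval_lin k x y :
  freeAssosym_eval (k *: x + y) = k *: freeAssosym_eval x + freeAssosym_eval y.
Proof.
rewrite -(proj_surj x) -(proj_surj y) -[k *: _]projZ -projD.
by rewrite !freeAssosym_eval_proj /freeNA_eval linextD linextZ.
Qed.

Lemma freeAssosym_evalM x y :
  freeAssosym_eval (amul x y) = amul (freeAssosym_eval x) (freeAssosym_eval y).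
Proof.
rewrite -(proj_surj x) -(proj_surj y) -[amul _ _]projM.
by rewrite !freeAssosym_eval_proj freeNA_evalM.
Qed.

Lemma freeAssosym_eval_generator i : freeAssosym_eval (generator K i) = a i.
Proof.
by rewrite freeAssosym_eval_proj /freeNA_eval linextU scale1r.
Qed.

End FreeAssosymEval.

Section Morphism.
Variables (K : fieldType) (A B : naAlgType K) (f : A -> B) (X : eqType) (g : X -> A).
Hypotheses (flin : forall k x y, f (k *: x + y) = k *: f x + f y)
           (fM : forall x y, f (amul x y) = amul (f x) (f y)).

Lemma morph_sub x y : f (x - y) = f x - f y.
Proof. by rewrite addrC -scaleN1r flin scaleN1r addrC. Qed.

Lemma morph_word_eval w : f (word_eval g w) = word_eval (f \o g) w.
Proof. by elim: w => //= u IHu v IHv; rewrite fM IHu IHv. Qed.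

Lemma morph_tail_monomial u t :
  f (tail_monomial g u t) = tail_monomial (f \o g) u t.
Proof.
have f0 : f 0 = 0 by have := morph_sub 0 0; rewrite !subrr.
elim: u => [|x u IH] /=; last by rewrite /gen_mul fM IH.
case: t => [|x [|y [|z t]]] //=.
have -> : associator ((f \o g) x) ((f \o g) y) ((f \o g) z)
    = f (associator (g x) (g y) (g z)).
  by rewrite !associatorE morph_sub !fM.
elim: t (associator _ _ _) => //= a t IH v.
by rewrite IH /gen_comm morph_sub !fM.
Qed.

End Morphism.

(** The free associative algebra with unit, as the algebra of the free monoid. It separates words
    and kills every tail monomial. *)
Definition word_algebra (K : fieldType) (X : choiceType) : Type :=
  {malg K[{fmonom X}]}.

HB.instance Definition _ K X := GRing.Lmodule.on (word_algebra K X).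

Section WordAlgebra.
Variables (K : fieldType) (X : choiceType).
Implicit Types x y z : word_algebra K X.

Definition word_algebra_mul x y : word_algebra K X :=
  (x : {malg K[{fmonom X}]}) * (y : {malg K[{fmonom X}]}).

Lemma word_algebra_mulDl x y z :
  word_algebra_mul (x + y) z = word_algebra_mul x z + word_algebra_mul y z.
Proof. exact: mulrDl. Qed.

Lemma word_algebra_mulDr x y z :
  word_algebra_mul x (y + z) = word_algebra_mul x y + word_algebra_mul x z.
Proof. exact: mulrDr. Qed.

Lemma word_algebra_mulZl c x y :
  word_algebra_mul (c *: x) y = c *: word_algebra_mul x y.
Proof. exact: esym (scalerAl _ _ _). Qed.

Lemma word_algebra_mulZr c x y :
  word_algebra_mul x (c *: y) = c *: word_algebra_mul x y.
Proof.
rewrite /word_algebra_mul (malgMEw (fsubset_refl _) (msuppZ_le c y)) malgME.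
rewrite scaler_sumr; apply: eq_bigr => u _; rewrite scaler_sumr.
apply: eq_bigr => v _; apply/malgP => m.
by rewrite !(mcoeffZ, mcoeffU) mulrnAr mulrCA.
Qed.

HB.instance Definition _ := Lmodule_isNAAlgebra.Build K (word_algebra K X)
  word_algebra_mulDl word_algebra_mulDr word_algebra_mulZl word_algebra_mulZr.

Lemma word_algebra_associator x y z : associator x y z = 0.
Proof. by rewrite associatorE /amul /= /word_algebra_mul mulrA subrr. Qed.

Definition word_algebra_gen i : word_algebra K X := << FMonom [:: i] >>.

Lemma word_algebra_eval w :
  word_eval word_algebra_gen w = << FMonom (letters w) >>.
Proof.
elim: w => //= u -> v ->; rewrite /amul /= /word_algebra_mul malgM_def fgmulUU.
rewrite mulr1; congr mkmalgU; apply/val_inj => /=.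
by rewrite fmM.
Qed.

Lemma word_algebra_tail u t : tail_monomial word_algebra_gen u t = 0.
Proof.
elim: u => [|x u IH] /=; last by rewrite /gen_mul IH amul0r.
case: t => [|x [|y [|a t]]] //=; rewrite word_algebra_associator.
by elim: t => //= b t IH; rewrite /gen_comm amul0l amul0r subrr.
Qed.

End WordAlgebra.

(* A triple is [(p, q, d)]. The left and right actions on the last component
   are through [p] and [q], and [p - q] is a derivation into it; minus the cup
   square of this derivation is a cochain whose coboundary is its cup cube, so
   adding it to the product makes the associator symmetric. *)
Definition twisted (R : Type) : Type := (R * R * R)%type.

HB.instance Definition _ (K : fieldType) (R : comAlgType K) :=
  GRing.Lmodule.copy (twisted R) (R * R * R)%type.

Section Twisted.
Variables (K : fieldType) (R : comAlgType K).
Implicit Types x y z : twisted R.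

Definition twisted_mul x y : twisted R :=
  (x.1.1 * y.1.1, x.1.2 * y.1.2,
   x.1.1 * y.2 + y.1.2 * x.2 - (x.1.1 - x.1.2) * (y.1.1 - y.1.2)).

Lemma twisted_mulDl x y z : twisted_mul (x + y) z = twisted_mul x z + twisted_mul y z.
Proof.
by rewrite /twisted_mul /=; congr (_, _, _); rewrite /=; ring.
Qed.

Lemma twisted_mulDr x y z : twisted_mul x (y + z) = twisted_mul x y + twisted_mul x z.
Proof.
by rewrite /twisted_mul /=; congr (_, _, _); rewrite /=; ring.
Qed.

Lemma twisted_mulZl c x y : twisted_mul (c *: x) y = c *: twisted_mul x y.
Proof.
rewrite /twisted_mul /=; congr (_, _, _); rewrite ?scalerAl //=.
by rewrite -!scalerBr -!scalerAl -scalerAr -scalerDr -scalerBr.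
Qed.

Lemma twisted_mulZr c x y : twisted_mul x (c *: y) = c *: twisted_mul x y.
Proof.
rewrite /twisted_mul /=; congr (_, _, _); rewrite ?scalerAr //=.
by rewrite -!scalerBr -!scalerAr -scalerAl -scalerDr -scalerBr.
Qed.

HB.instance Definition _ := Lmodule_isNAAlgebra.Build K (twisted R)
  twisted_mulDl twisted_mulDr twisted_mulZl twisted_mulZr.

Lemma twisted_associator x y z :
  associator x y z
  = (0, 0, (x.1.1 - x.1.2) * (y.1.1 - y.1.2) * (z.1.1 - z.1.2)) :> twisted R.
Proof.
rewrite associatorE /amul /= /twisted_mul /=.
by congr (_, _, _); rewrite /=; ring.
Qed.

Lemma twisted_assosymmetric : assosymmetric (twisted R).
Proof.
by move=> x y z; rewrite !twisted_associator; split; congr (_, _, _); ring.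
Qed.

Variables (X : eqType) (p q : X -> R).

(** On triples [(0, 0, d)] the twisting term vanishes: left multiplication by a generator acts as
    [p i], right multiplication as [q i], and the commutator as [p i - q i]. *)
Lemma twisted_tail u t : (3 <= size t)%N ->
  tail_monomial (fun i => (p i, q i, 0) : twisted R) u t
  = (0, 0, \prod_(i <- u) p i * \prod_(i <- t) (p i - q i)).
Proof.
move=> t3; elim: u => [|x u IH] /=; last first.
  rewrite IH /gen_mul /amul /= /twisted_mul /= !mulr0 big_cons.
  by congr (_, _, _); ring.
rewrite big_nil mul1r; case: t t3 => [|x [|y [|z t]]] //= _.
rewrite !big_cons !mulrA twisted_associator /=.
elim: t (_ * _ * _) => [|a t IH] d; first by rewrite big_nil mulr1.
rewrite big_cons mulrA /= -IH /gen_comm; congr foldl.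
by rewrite /amul /= /twisted_mul; congr (_, _, _); rewrite /=; ring.
Qed.

End Twisted.

(** The pairing matrix is block triangular with identity diagonal blocks: [f1] detects the
    coefficients on [b1], and once these vanish [f2] detects those on [b2]. *)
Lemma has_dim_dual (K : fieldType) (V : lmodType K) (T1 T2 : finType)
    (b1 : T1 -> V) (b2 : T2 -> V) (f1 : T1 -> V -> K) (f2 : T2 -> V -> K) :
    (forall i k x y, f1 i (k *: x + y) = k * f1 i x + f1 i y) ->
    (forall i k x y, f2 i (k *: x + y) = k * f2 i x + f2 i y) ->
    (forall i j, f1 i (b1 j) = (j == i)%:R) -> (forall i j, f1 i (b2 j) = 0) ->
    (forall i j, f2 i (b2 j) = (j == i)%:R) ->
  has_dim (span (fun v => (exists i, v = b1 i) \/ (exists i, v = b2 i)))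
          (#|T1| + #|T2|).
Proof.
move=> f1lin f2lin f1b1 f1b2 f2b2.
have flin0 (f : V -> K) : (forall k x y, f (k *: x + y) = k * f x + f y) -> f 0 = 0.
  by move/(_ (-1) 0 0); rewrite scaler0 addr0 mulN1r addNr.
have sumE (f : V -> K) (T : finType) (c : T -> K) (b : T -> V) :
    (forall k x y, f (k *: x + y) = k * f x + f y) ->
    f (\sum_i c i *: b i) = \sum_i c i * f (b i).
  move=> flin; have f0 := flin0 _ flin.
  rewrite (big_morph f (id1 := 0) (op1 := +%R)) //.
    by apply: eq_bigr => i _; rewrite -[_ *: _]addr0 flin f0 addr0.
  by move=> x y; rewrite -[x]scale1r flin mul1r scale1r.
have sum_delta (T : finType) (c : T -> K) i : \sum_j c j * (j == i)%:R = c i.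
  rewrite (bigD1 i) //= eqxx mulr1 big1 ?addr0 // => j /negPf->.
  by rewrite mulr0.
pose c1 (c : 'I_(#|T1| + #|T2|) -> K) i := c (lshift _ (enum_rank i)).
pose c2 (c : 'I_(#|T1| + #|T2|) -> K) i := c (rshift _ (enum_rank i)).
pose b (i : 'I_(#|T1| + #|T2|)) : V := 
  match split i with inl j => b1 (enum_val j) | inr j => b2 (enum_val j) end.
have bE c : \sum_i c i *: b i = \sum_i c1 c i *: b1 i + \sum_i c2 c i *: b2 i.
  rewrite big_split_ord; congr (_ + _).
    rewrite (reindex (@enum_rank T1)); last exact/onW_bij/enum_rank_bij.
    apply: eq_bigr => i _.
    by rewrite /b (unsplitK (inl _)) enum_rankK.
  rewrite (reindex (@enum_rank T2)); last exact/onW_bij/enum_rank_bij.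
  apply: eq_bigr => i _.
  by rewrite /b (unsplitK (inr _)) enum_rankK.
exists b; split=> [c|v].
  rewrite bE => c0; have c1_0 i : c1 c i = 0.
    have := congr1 (f1 i) c0; rewrite -[X in f1 i (X + _)]scale1r f1lin !sumE //.
    rewrite mul1r (flin0 _ (f1lin i)) [X in _ + X]big1 => [|j _].
      by under eq_bigr do rewrite f1b1; rewrite sum_delta addr0.
    by rewrite f1b2 mulr0.
  move: c0; rewrite big1 ?add0r => [c0|i _]; last by rewrite c1_0 scale0r.
  have c2_0 i : c2 c i = 0.
    have := congr1 (f2 i) c0; rewrite sumE // (flin0 _ (f2lin i)).
    by under eq_bigr do rewrite f2b2; rewrite sum_delta.
  move=> i; case: (split_ordP i) => j ->.
    by have := c1_0 (enum_val j); rewrite /c1 enum_valK.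
  by have := c2_0 (enum_val j); rewrite /c2 enum_valK.
split=> [|[c ->]].
  move: v; apply: span_elim => [|k _ _ [c ->] [d ->]|w].
  - by exists (fun=> 0); rewrite big1 // => i _; rewrite scale0r.
  - exists (fun i => k * c i + d i); rewrite scaler_sumr -big_split /=.
    by apply: eq_bigr => i _; rewrite scalerDl scalerA.
  - case=> [[i ->]|[i ->]].
      exists (fun j => (j == lshift _ (enum_rank i))%:R).
      rewrite (bigD1 (lshift _ (enum_rank i))) //= eqxx scale1r big1 => [|j /negPf->].
        by rewrite addr0 /b (unsplitK (inl _)) enum_rankK.
      by rewrite scale0r.
    exists (fun j => (j == rshift _ (enum_rank i))%:R).
    rewrite (bigD1 (rshift _ (enum_rank i))) //= eqxx scale1r big1 => [|j /negPf->].
      by rewrite addr0 /b (unsplitK (inr _)) enum_rankK.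
    by rewrite scale0r.
elim/big_ind: _ => [|x y|i _]; [exact: span0 | exact: spanD |].
by apply/spanZ/span_gen; rewrite /b; case: split => j; [left|right]; exists (enum_val j).
Qed.

Lemma eq_has_dim (K : fieldType) (V : lmodType K) (W W' : V -> Prop) d :
  (forall v, W v <-> W' v) -> has_dim W d -> has_dim W' d.
Proof.
move=> WW' [b [bfree bgen]]; exists b; split=> // v.
exact: iff_trans (iff_sym (WW' v)) (bgen v).
Qed.

Section MultisetSeq.
Variable r : nat.
Implicit Types (f : 'I_r -> nat) (s : seq 'I_r).

Definition mult s : {ffun 'I_r -> nat} := [ffun i => count_mem i s].

Definition seq_of_mult f : seq 'I_r := flatten [seq nseq (f i) i | i <- enum 'I_r].

Lemma count_seq_of_mult f i : count_mem i (seq_of_mult f) = f i.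
Proof.
rewrite count_flatten -map_comp sumnE big_map big_enum /= (bigD1 i) //=.
by rewrite count_nseq /= eqxx mul1n big1 ?addn0 // => j /negPf; rewrite count_nseq /= => ->.
Qed.

Lemma size_seq_of_mult f : size (seq_of_mult f) = (\sum_i f i)%N.
Proof.
rewrite size_flatten /shape -map_comp sumnE big_map big_enum /=.
by apply: eq_bigr => i _; rewrite size_nseq.
Qed.

Lemma perm_mult s s' : (perm_eq s s') = (mult s == mult s').
Proof.
apply/idP/eqP => [/permP ss'|/ffunP ss']; first by apply/ffunP => i; rewrite !ffunE.
by apply/allP => i _; have := ss' i; rewrite !ffunE => /eqP.
Qed.

Lemma perm_seq_of_mult s f : (forall i, f i = count_mem i s) -> perm_eq s (seq_of_mult f).
Proof.
by move=> fs; rewrite perm_mult; apply/eqP/ffunP => i; rewrite !ffunE count_seq_of_mult.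
Qed.

Lemma sum_mult s : (\sum_i mult s i)%N = size s.
Proof.
have /perm_size -> := @perm_seq_of_mult s (mult s) (fun i => ffunE _ i).
by rewrite size_seq_of_mult.
Qed.

End MultisetSeq.

Lemma malg_prodU (K : fieldType) (M : monomType) (T : Type) (f : T -> M) (s : seq T) :
  \prod_(i <- s) (<< f i >> : {malg K[M]}) = << \big[mmul/mone]_(i <- s) f i >>.
Proof.
elim: s => [|i s IH]; first by rewrite !big_nil mpolyC1E.
by rewrite !big_cons IH malgM_def fgmulUU mulr1.
Qed.

Section TailMonomialDual.
Variables (K : fieldType) (r : nat).
Local Notation F := (freeAssosym K 'I_r).
Local Notation g := (@generator K 'I_r).
Local Notation R := {malg K[{cmonom ('I_r + 'I_r)%type}]}.

Definition word_coef (s : seq 'I_r) (x : F) : K :=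
  (freeAssosym_eval (@word_algebra_gen K 'I_r) x : {malg K[{fmonom 'I_r}]})@_(FMonom s).

Let word_assosymmetric : assosymmetric (word_algebra K 'I_r).
Proof. by move=> x y z; rewrite !word_algebra_associator. Qed.

Lemma word_coef_lin s k x y : word_coef s (k *: x + y) = k * word_coef s x + word_coef s y.
Proof.
rewrite /word_coef freeAssosym_eval_lin //.
by rewrite -mcoeffZ -mcoeffD.
Qed.

Lemma word_coef_monomial s w : word_coef s (monomial K w) = (letters w == s)%:R.
Proof.
rewrite /word_coef /monomial morph_word_eval; last exact: freeAssosym_evalM.
have -> : word_eval (freeAssosym_eval (@word_algebra_gen K 'I_r) \o g) w
    = word_eval (@word_algebra_gen K 'I_r) w.
  by elim: w => [i|u IHu v IHv] /=; rewrite ?IHu ?IHv ?freeAssosym_eval_generator.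
by rewrite word_algebra_eval mcoeffU.
Qed.

Lemma word_coef_tail s u t : word_coef s (tail_monomial g u t) = 0.
Proof.
rewrite /word_coef morph_tail_monomial; last first.
- exact: freeAssosym_evalM.
- exact: freeAssosym_eval_lin.
have -> : tail_monomial (freeAssosym_eval (@word_algebra_gen K 'I_r) \o g) u t
    = tail_monomial (@word_algebra_gen K 'I_r) u t.
  by congr (tail_monomial _ u t); apply/funext => i /=; rewrite freeAssosym_eval_generator.
by rewrite word_algebra_tail mcoeff0.
Qed.

(** The index [inl i] stands for the variable y_i of a left multiplication, [inr i] for the variable
    z_i of a letter in the symmetric core. *)
Definition tail_cmonom (u t : seq 'I_r) : {cmonom ('I_r + 'I_r)%type} :=
  mmul (\big[mmul/mone]_(i <- u) ucm (inl i)) (\big[mmul/mone]_(i <- t) ucm (inr i)).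

Lemma tail_cmonomE u t i :
  tail_cmonom u t (inl i) = count_mem i u /\ tail_cmonom u t (inr i) = count_mem i t.
Proof.
have prodE (f : 'I_r -> 'I_r + 'I_r) s x :
    (\big[@mmul {cmonom ('I_r + 'I_r)%type}/mone]_(j <- s) ucm (f j)) x
    = count (fun j => f j == x) s.
  elim: s => [|j s IH]; first by rewrite big_nil cm1.
  by rewrite big_cons cmM cmU IH.
rewrite /tail_cmonom !cmM !prodE; split; rewrite ?addn0.
  rewrite (eq_count (a2 := pred1 i)) // [X in (_ + X)%N](eq_count (a2 := pred0)) //.
  by rewrite count_pred0 addn0.
by rewrite (eq_count (a2 := pred0)) // count_pred0 add0n; apply: eq_count.
Qed.

Let y (i : 'I_r) : R := << ucm (inl i) >>.
Let z (i : 'I_r) : R := << ucm (inr i) >>.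

(** The right action [y i - z i] is chosen so that commutators act as the independent variable
    [z i]. *)
Let h (i : 'I_r) : twisted R := (y i, y i - z i, 0).

Definition tail_coef (m : {cmonom ('I_r + 'I_r)%type}) (x : F) : K :=
  (freeAssosym_eval h x).2@_m.

Lemma tail_coef_lin m k a b : tail_coef m (k *: a + b) = k * tail_coef m a + tail_coef m b.
Proof.
rewrite /tail_coef freeAssosym_eval_lin; last exact: twisted_assosymmetric.
by rewrite -mcoeffZ -mcoeffD.
Qed.

Lemma tail_coef_tail m u t : (3 <= size t)%N ->
  tail_coef m (tail_monomial g u t) = (tail_cmonom u t == m)%:R.
Proof.
move=> t3; rewrite /tail_coef morph_tail_monomial; last first.
- by apply: freeAssosym_evalM; apply: twisted_assosymmetric.
- by apply: freeAssosym_eval_lin; apply: twisted_assosymmetric.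
have -> : tail_monomial (freeAssosym_eval h \o g) u t = tail_monomial h u t.
  congr (tail_monomial _ u t); apply/funext => i /=.
  by rewrite freeAssosym_eval_generator //; apply: twisted_assosymmetric.
rewrite twisted_tail //= [\prod_(i <- t) _](eq_bigr z) => [|i _]; last first.
  by rewrite opprB addrC subrK.
by rewrite !malg_prodU malgM_def fgmulUU mulr1 mcoeffU.
Qed.

End TailMonomialDual.

(** Pairs of multisets (I, J) with |J| >= 3 and total size [n], as multiplicity functions bounded by
    [n] to keep the type finite. The condition [Q] on total multiplicities lets multidegrees and
    degrees be treated at once. *)
Definition tail_index (r n : nat) (Q : pred {ffun 'I_r -> nat}) :
    {set {ffun 'I_r -> 'I_n.+1} * {ffun 'I_r -> 'I_n.+1}} :=
  [set p : {ffun 'I_r -> 'I_n.+1} * {ffun 'I_r -> 'I_n.+1} |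
           [&& (\sum_i (p.1 i + p.2 i) == n)%N, (2 < \sum_i p.2 i)%N &
               Q [ffun i => (p.1 i + p.2 i)%N]]].

(** * Bases of homogeneous components *)

Section DimensionCount.
Variables (K : fieldType) (r n : nat) (Q : pred {ffun 'I_r -> nat}).
Hypotheses (char_neq2 : 2%N \notin [pchar K]) (char_neq3 : 3%N \notin [pchar K]).
Hypothesis n_gt0 : (0 < n)%N.
Local Notation F := (freeAssosym K 'I_r).
Local Notation g := (@generator K 'I_r).

Let Fas : assosymmetric F := @freeAssosym_assosymmetric K 'I_r.
Let S1 := [set t : n.-tuple 'I_r | Q (mult t)].
Let S2 := tail_index n Q.

Let T1 := {t | t \in S1}.
Let T2 := {p | p \in S2}.

Let sq (f : {ffun 'I_r -> 'I_n.+1}) : seq 'I_r := seq_of_mult (fun i => f i).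

(** The value 0 on the empty tuple is never taken, since [n] is positive. *)
Let b1 (t : T1) : F := if tval (val t) is x :: s then monomial K (rnorm x s) else 0.
Let b2 (p : T2) : F := tail_monomial g (sq (val p).1) (sq (val p).2).

Let W := span (fun v => exists2 w : word 'I_r,
  size (letters w) = n /\ Q (mult (letters w)) & v = monomial K w).
Let B := span (fun v => (exists i, v = b1 i) \/ (exists i, v = b2 i)).

Let tail_in_B s u t : size s = n -> Q (mult s) -> (3 <= size t)%N ->
  perm_eq (u ++ t) s -> B (tail_monomial g u t).
Proof.
move=> sn Qs t3 uts.
have le_n (v : seq 'I_r) i : (count_mem i v <= size (u ++ t) -> count_mem i v < n.+1)%N.
  by rewrite (perm_size uts) sn ltnS.
have le_u i : (count_mem i u <= size (u ++ t))%N.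
  by rewrite size_cat (leq_trans (count_size _ _)) ?leq_addr.
have le_t i : (count_mem i t <= size (u ++ t))%N.
  by rewrite size_cat (leq_trans (count_size _ _)) ?leq_addl.
pose p : {ffun 'I_r -> 'I_n.+1} * {ffun 'I_r -> 'I_n.+1} :=
  ([ffun i => Ordinal (le_n u i (le_u i))], [ffun i => Ordinal (le_n t i (le_t i))]).
have pE : [ffun i => (p.1 i + p.2 i)%N] = mult s.
  have /eqP <- : mult (u ++ t) == mult s by rewrite -perm_mult.
  by apply/ffunP => i; rewrite !ffunE count_cat.
have p2E : (\sum_i p.2 i)%N = size t.
  by rewrite -sum_mult; apply: eq_bigr => i _; rewrite !ffunE.
have pS2 : p \in S2.
  rewrite inE pE Qs p2E t3 !andbT; apply/eqP; apply: etrans sn.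
  by rewrite -sum_mult -pE; apply: eq_bigr => i _; rewrite !ffunE.
apply: span_gen; right; exists (exist _ p pS2); rewrite /b2 /=.
by apply: tail_monomial_perm => //; apply: perm_seq_of_mult => i; rewrite ffunE.
Qed.

(** In one direction a word is replaced by its right-normed form modulo tail monomials; in the
    other, tail monomials expand into words. Both keep the letter multiplicities, hence [Q]. *)
Let W_B v : W v <-> B v.
Proof.
split; apply: span_elim; rewrite -?/B -?/W; try exact: span0.
- by move=> *; apply: span_lin.
- move=> _ [w [wn Qw] ->]; have [x [s ws]] := letters_neq0 w.
  have := tail_span_rnorm g char_neq2 char_neq3 Fas ws.
  rewrite -ws => sp; rewrite -[monomial K w](subrK (monomial K (rnorm x s))).
  apply: spanD.
    apply: span_elim sp; [exact: span0 | by move=> *; apply: span_lin |].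
    by move=> _ [u [t [t3 ut ->]]]; apply: tail_in_B Qw t3 ut.
  have szs : size (x :: s) == n by rewrite -ws wn.
  have tS1 : Tuple szs \in S1 by rewrite inE /= -ws.
  by apply: span_gen; left; exists (exist _ (Tuple szs) tS1).
- by move=> *; apply: span_lin.
move=> _ [[[t tS1] ->]|[[p pS2] ->]].
  rewrite /b1 /=; case: t tS1 => -[|x s] /= szs.
    by move=> _; exfalso; move: n_gt0; rewrite -(eqP szs).
  rewrite inE => Qs; apply: span_gen; exists (rnorm x s) => //.
  by rewrite letters_rnorm; split=> //; apply/eqP.
rewrite /b2 /=; move: pS2; rewrite inE => /and3P[/eqP sumn ge3 Qp].
set u := sq p.1; set t := sq p.2.
have t3 : (3 <= size t)%N by rewrite size_seq_of_mult.
apply: span_elim (word_span_tail_monomial g u t3).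
- exact: span0.
- by move=> *; apply: span_lin.
move=> _ [w wut ->]; apply: span_gen; exists w => //; split.
  by rewrite (perm_size wut) size_cat !size_seq_of_mult -big_split.
have -> : mult (letters w) = [ffun i => (p.1 i + p.2 i)%N] => //.
move: wut; rewrite perm_mult => /eqP ->; apply/ffunP => i.
by rewrite !ffunE count_cat !count_seq_of_mult.
Qed.

Lemma has_dim_words : has_dim W (#|S1| + #|S2|).
Proof.
have -> : (#|S1| + #|S2|)%N = (#|{: T1}| + #|{: T2}|)%N by rewrite !card_sig.
apply: eq_has_dim (fun v => iff_sym (W_B v)) _.
pose f1 (t : T1) := word_coef (K := K) (val t).
pose f2 (p : T2) := tail_coef (K := K)
  (tail_cmonom (sq (val p).1) (sq (val p).2)).
apply: (has_dim_dual (f1 := f1) (f2 := f2)) => [i|i|i j|i j|i j].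
- exact: word_coef_lin.
- exact: tail_coef_lin.
- rewrite /f1 /b1; case: j => -[[|x s] /= szs] jS1.
    by exfalso; move: n_gt0; rewrite -(eqP szs).
  by rewrite word_coef_monomial letters_rnorm; congr (_%:R).
- by rewrite /f1 word_coef_tail.
case: j => p pS2; rewrite /f2 /b2 /= tail_coef_tail; last first.
  by rewrite size_seq_of_mult; move: pS2; rewrite inE => /and3P[].
congr (nat_of_bool _)%:R; apply/eqP/eqP => [ij|<- //]; apply: val_inj => /=.
(* The exponents of the commutative monomial recover both multisets. *)
have [e1 e2] : p.1 =1 (val i).1 /\ p.2 =1 (val i).2.
  split=> k; apply: val_inj; have [h1 h2] := tail_cmonomE
    (sq p.1) (sq p.2) k;
  have [h3 h4] := tail_cmonomE
    (sq (val i).1) (sq (val i).2) k;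
  rewrite ij h3 h4 /sq !count_seq_of_mult in h1 h2; by [].
by rewrite [LHS]surjective_pairing [RHS]surjective_pairing; congr pair; apply/ffunP.
Qed.

End DimensionCount.

(** * Counting *)

Section WordCount.
Variable r : nat.
Implicit Types l : 'I_r -> nat.

Definition words_of_mult n l : {set n.-tuple 'I_r} :=
  [set t : n.-tuple 'I_r | [forall i, mult t i == l i]].

(** Words are sorted by their first letter, whose multiplicity drops by one in the rest. *)
Lemma card_words_of_mult_rec n l :
  (#|words_of_mult n.+1 l| =
   \sum_(x | (0 < l x)%N) #|words_of_mult n (fun i => (l i - (x == i))%N)|)%N.
Proof.
rewrite -sum1_card.
pose thd (t : n.+1.-tuple 'I_r) := thead t.
rewrite (partition_big thd (fun x => 0 < l x)%N) => [|t]; last first.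
  rewrite inE => /forallP/(_ (thead t))/eqP <-; rewrite ffunE.
  by case/tupleP: t => x t /=; rewrite theadE eqxx.
apply: eq_bigr => x lx; rewrite -sum1_card.
rewrite (reindex_onto (fun t : n.-tuple 'I_r => [tuple of x :: t])
                      (fun t : n.+1.-tuple 'I_r => [tuple of behead t])) => [|t].
  apply: eq_bigl => t; rewrite !inE /thd theadE eqxx andbT.
  have -> : [tuple of behead (x :: t)] == t by apply/eqP/val_inj.
  rewrite andbT; apply/forallP/forallP => h i; move: (h i); rewrite !ffunE /=.
    by move=> /eqP <-; rewrite addKn.
  have [<-|] := eqVneq x i; last by rewrite subn0.
  by move/eqP=> ->; rewrite subnKC.
by case/andP=> _ /eqP <-; apply/val_inj; rewrite [in RHS](tuple_eta t).
Qed.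

(** The product form of the multinomial coefficient avoids division; the recursion on the first
    letter matches the decomposition of (n+1)! as the sum of the [l x] times n!. *)
Lemma card_words_of_mult n l :
  n = (\sum_i l i)%N -> (#|words_of_mult n l| * \prod_i (l i)`! = n`!)%N.
Proof.
elim: n l => [|n IH] l ln.
  have l0 i : l i = 0%N.
    by apply/eqP; rewrite -leqn0 ln (bigD1 i) //= leq_addr.
  rewrite big1 => [|i _]; last by rewrite l0.
  rewrite muln1 (_ : words_of_mult 0 l = [set [tuple]]) ?cards1 //.
  apply/setP => t; rewrite !inE tuple0 eqxx; apply/forallP => i.
  by rewrite ffunE l0.
rewrite card_words_of_mult_rec big_distrl /= factS ln big_distrl /=.
rewrite [RHS](bigID (fun x => 0 < l x)%N) /= [X in _ = (_ + X)%N]big1 => [|x]; last first.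
  by rewrite -eqn0Ngt => /eqP ->.
rewrite addn0; apply: eq_bigr => x lx.
set l' := fun i => _.
have l'n : n = (\sum_i l' i)%N.
  rewrite (bigD1 x) //= in ln; rewrite (bigD1 x) //= /l' eqxx.
  rewrite (eq_bigr l) => [|i /negPf]; last by rewrite eq_sym => ->; rewrite subn0.
  by move: lx ln; case: (l x) => // k _; rewrite subn1 addSn => -[].
rewrite -(IH l' l'n) mulnCA; congr (_ * _)%N.
rewrite (bigD1 x) //= [in RHS](bigD1 x) //= /l' eqxx mulnA.
congr (_ * _)%N; first by move: lx; case: (l x) => // k _; rewrite factS subn1.
by apply: eq_bigr => i /negPf; rewrite eq_sym => ->; rewrite subn0.
Qed.

End WordCount.

Section MultCount.
Variables (r n : nat).
Local Notation A := {ffun 'I_r -> 'I_n.+1}.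
Implicit Types (l : 'I_r -> nat) (f : A).

(** The generating function of one multiplicity that is at most [m]. *)
Definition geom_poly m : {poly nat} := \poly_(i < m.+1) 1%N.

Definition mults_below l : {set A} := [set f : A | [forall i, (f i <= l i)%N]].

Lemma card_mults_below_sum l k : (forall i, (l i <= n)%N) ->
  #|[set f in mults_below l | (\sum_i f i == k)%N]| = (\prod_i geom_poly (l i))`_k.
Proof.
move=> ln; have geomE m : (m <= n)%N ->
    geom_poly m = \sum_(j : 'I_n.+1 | (j <= m)%N) 'X^j.
  move=> mn; rewrite /geom_poly poly_def.
  rewrite (big_ord_widen_cond n.+1 predT (fun i => 1%N *: 'X^i)) //.
  by apply: eq_bigr => j _; rewrite scale1r.
rewrite (eq_bigr _ (fun i _ => geomE _ (ln i))) bigA_distr_big_dep coef_sum.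
under eq_bigr => f _ do rewrite prodrXr coefXn.
rewrite -sum1_card.
transitivity (\sum_(f : A | [forall i, (f i <= l i)%N]) (k == (\sum_i f i)%N))%N.
  rewrite [RHS]big_mkcond [LHS]big_mkcond; apply: eq_bigr => f _.
  by rewrite !inE eq_sym; case: [forall i, _]; case: eqP.
by apply: eq_bigr => f _; case: eqP.
Qed.

Lemma card_mults_below l : (forall i, (l i <= n)%N) ->
  #|mults_below l| = (\prod_i (l i).+1)%N.
Proof.
move=> ln; rewrite cardsE; transitivity #|family (fun i (j : 'I_n.+1) => (j <= l i)%N)|.
  by apply: eq_card => f; apply/forallP/familyP.
rewrite card_family foldrE big_map big_enum; apply: eq_bigr => i _.
rewrite -sum1_card (eq_bigl (fun j : 'I_n.+1 => (j < (l i).+1)%N)) //.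
by rewrite -(big_ord_widen n.+1 (fun=> 1%N)) ?ltnS // sum1_card card_ord.
Qed.

(** Up to degree [n] the polynomial agrees with the series 1/(1 - X); the inner induction is the
    hockey-stick identity. *)
Lemma geom_poly_exp m k :
  (k <= n)%N -> (geom_poly n ^+ m.+1)`_k = 'C(k + m, m).
Proof.
elim: m k => [|m IH] k kn.
  by rewrite expr1 coef_poly ltnS kn bin0.
rewrite exprSr coefM.
have -> : \sum_(j < k.+1) (geom_poly n ^+ m.+1)`_j * (geom_poly n)`_(k - j)
    = (\sum_(j < k.+1) 'C(j + m, m))%N.
  apply: eq_bigr => j _; rewrite IH; last by rewrite (leq_trans _ kn) // -ltnS.
  by rewrite coef_poly ltnS (leq_trans (leq_subr _ _) kn) mulr1.
elim: k {kn} => [|k IHk]; first by rewrite big_ord1 !add0n !binn.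
by rewrite big_ord_recr /= IHk [(k.+1 + m.+1)%N]addnS binS addSnnS.
Qed.

(** Counts the multisets J that are too small for an associator. In degree 2 these are two distinct
    letters, or twice one letter of multiplicity at least 2. *)
Lemma low_coefs_prod (s : seq nat) : all (leq 1) s ->
  let P := \prod_(m <- s) geom_poly m in
  [/\ P`_0 = 1%N, P`_1 = size s &
      P`_2 = ('C(size s, 2) + count (leq 2) s)%N].
Proof.
elim: s => [|m s IH] /=; first by rewrite big_nil !coef1.
case/andP=> m1 /IH [h0 h1 h2]; rewrite big_cons !coefM.
rewrite !big_ord_recr !big_ord0 /= h0 h1 h2 !coef_poly /=.
rewrite !ltnS m1 !natrE !mul1n !add0n binS bin1.
by split; rewrite ?add0n ?mul1n ?addn1 //; case: leqP => _; lia.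
Qed.


Lemma card_tail_index_partition (Q : pred {ffun 'I_r -> nat}) :
  xpredT =1 Q -> #|tail_index n Q| =
  (\sum_(k < n.+1 | 2 < k) #|[set f : A | (\sum_i f i == n - k)%N]| *
                            #|[set f : A | (\sum_i f i == k)%N]|)%N.
Proof.
move=> QT; pose deg2 (p : A * A) : 'I_n.+1 := inord (\sum_i p.2 i)%N.
have deg2E (p : A * A) : (\sum_i (p.1 i + p.2 i) == n)%N ->
    deg2 p = (\sum_i p.2 i)%N :> nat.
  by move=> /eqP pn; rewrite inordK // ltnS -[X in (_ <= X)%N]pn big_split leq_addl.
rewrite -sum1_card (partition_big deg2 (fun k => 2 < k)%N) => [|p]; last first.
  by rewrite inE => /and3P[/deg2E -> ].
apply: eq_bigr => k k2; rewrite -cardsX -sum1_card; apply: eq_bigl => p.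
rewrite !inE -QT andbT; apply/andP/andP => [[/andP[pn p2] /eqP <-]|[/eqP p1 /eqP p2]].
  by rewrite deg2E // eqxx -[X in _ == (X - _)%N](eqP pn) big_split /= addnK eqxx.
have pn : (\sum_i (p.1 i + p.2 i) == n)%N.
  by rewrite big_split /= p1 p2 subnK // -ltnS.
by rewrite pn p2 k2 -val_eqE /= deg2E // p2.
Qed.

End MultCount.

Lemma card_mults_sum r n k : (k <= n)%N ->
  #|[set f : {ffun 'I_r.+1 -> 'I_n.+1} | (\sum_i f i == k)%N]| = 'C(k + r, r).
Proof.
move=> kn; have := card_mults_below_sum k (fun=> leqnn n : (n <= n)%N) (r := r.+1).
rewrite prodr_const card_ord geom_poly_exp // => <-; apply: eq_card => f.
rewrite !inE (_ : [forall i, _]) //; apply/forallP => i.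
by rewrite -ltnS.
Qed.

(** All pairs of multisets of total size [n] on [r.+1] letters are multisets on twice as many
    letters; the added terms are the pairs with |J| = 0, 1, 2. The factor [1 < n] removes the last
    term for [n = 1], where the truncated [n - 2] would contribute wrongly. *)
Lemma card_tail_index_all r n (Q : pred {ffun 'I_r.+1 -> nat}) :
    xpredT =1 Q -> (0 < n)%N ->
  (#|tail_index n Q| + ('C(n + r, r) + r.+1 * 'C(n - 1 + r, r) +
     (1 < n) * ('C(r.+2, 2) * 'C(n - 2 + r, r)))
   = 'C(n + (r + r.+1), r + r.+1))%N.
Proof.
move=> QT n0; rewrite (card_tail_index_partition n QT).
pose a k := ('C(n - k + r, r) * 'C(k + r, r))%N.
have -> : (\sum_(k < n.+1 | 2 < k)
    #|[set f : {ffun 'I_r.+1 -> 'I_n.+1} | \sum_i f i == n - k]| *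
    #|[set f : {ffun 'I_r.+1 -> 'I_n.+1} | \sum_i f i == k]| =
    \sum_(k < n.+1 | 2 < k) a k)%N.
  by apply: eq_bigr => k _; rewrite !card_mults_sum ?leq_subr // -ltnS.
(* The convolution is a coefficient of a power of [geom_poly n] whose exponent is split as
   [r.+1 + r.+1]. *)
have <- : (\sum_(k < n.+1) a k = 'C(n + (r + r.+1), r + r.+1))%N.
  rewrite -(@geom_poly_exp n _ n) // -addSn exprD coefM.
  apply: eq_bigr => k _; rewrite mulrC !geom_poly_exp ?leq_subr //.
  by rewrite -ltnS.
rewrite [RHS](bigID (fun k : 'I_n.+1 => 2 < k)%N) /=; congr (_ + _)%N.
have a0 : a 0%N = 'C(n + r, r) by rewrite /a subn0 add0n binn muln1.
have a1 : a 1%N = (r.+1 * 'C(n - 1 + r, r))%N.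
  by rewrite /a add1n binSn mulnC.
have a2 : a 2%N = ('C(r.+2, 2) * 'C(n - 2 + r, r))%N.
  by rewrite /a add2n mulnC -[in RHS](@bin_sub r.+2 2) // subSS subSS subn0.
rewrite -a0 -a1 -a2; case: n n0 a {a0 a1 a2} => [|[|n]] // _ a.
  by rewrite big_mkcond !big_ord_recl big_ord0 /= !addn0.
rewrite big_mkcond !big_ord_recl big1 => [|i _] //=.
by rewrite mul1n addn0 addnA.
Qed.

(** The first multiset is the complement of the second in [l], so the second alone indexes the
    pair. *)
Lemma card_tail_index_mult r (l : 'I_r -> nat) n (Q : pred {ffun 'I_r -> nat}) :
    n = (\sum_i l i)%N -> (forall m, Q m = [forall i, m i == l i]) ->
  #|tail_index n Q| = #|[set f in mults_below n l | (2 < \sum_i f i)%N]|.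
Proof.
move=> nE QE; have le_n i : (l i < n.+1)%N.
  by rewrite ltnS nE (bigD1 i) //= leq_addr.
pose h (f : {ffun 'I_r -> 'I_n.+1}) : {ffun 'I_r -> 'I_n.+1} * {ffun 'I_r -> 'I_n.+1} :=
  ([ffun i => inord (l i - f i)], f).
have hE f i : (h f).1 i = (l i - f i)%N :> nat.
  by rewrite ffunE inordK // (leq_ltn_trans (leq_subr _ _)).
rewrite -(card_imset _ (_ : injective h)) => [|f f' []//].
apply: eq_card => -[f1 f2]; apply/idP/imsetP => [|[f]].
  rewrite inE QE /= => /and3P[_ f2_3 /forallP eql].
  have {}eql i : (f1 i + f2 i)%N = l i by have /eqP := eql i; rewrite ffunE.
  exists f2.
    by rewrite !inE f2_3 andbT; apply/forallP => i; rewrite -eql leq_addl.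
  congr pair; apply/ffunP => i; apply: val_inj.
  by have := hE f2 i; rewrite -eql addnK.
rewrite !inE => /andP[/forallP fl f3] [-> ->] {f1 f2}.
have eql i : ((h f).1 i + f i)%N = l i by rewrite hE subnK.
rewrite /= f3 QE /=; apply/andP; split.
  by apply/eqP; apply: etrans (esym nE); apply: eq_bigr => i _; apply: eql.
by apply/forallP => i; rewrite ffunE; apply/eqP/eql.
Qed.

(** The product counts all multisets below [l], and [low_coefs_prod] those with fewer than three
    elements. *)
Lemma card_tail_index_multideg r (l : 'I_r -> nat) n (Q : pred {ffun 'I_r -> nat}) :
    n = (\sum_i l i)%N -> (forall m, Q m = [forall i, m i == l i]) ->
    (forall i, (0 < l i)%N) ->
  (#|tail_index n Q| + (1 + r + ('C(r, 2) + #|[set i | 1 < l i]|))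
   = \prod_i (l i).+1)%N.
Proof.
move=> nE QE l1; have le_n i : (l i <= n)%N.
  by rewrite nE (bigD1 i) //= leq_addr.
rewrite (card_tail_index_mult nE QE) -(card_mults_below le_n).
have [] := @low_coefs_prod (map l (enum 'I_r)).
  by apply/allP => _ /mapP[i _ ->].
rewrite big_map big_enum size_map size_enum_ord -!(card_mults_below_sum _ le_n).
have -> : count (leq 2) (map l (enum 'I_r)) = #|[set i | (1 < l i)%N]|.
  by rewrite count_map -sum1_count big_enum_cond -sum1_card; apply: eq_bigl => i; rewrite inE.
move=> h0 h1 h2.
transitivity (\sum_(f in mults_below n l) ((2 < \sum_i f i) +
    ((\sum_i f i == 0) + (\sum_i f i == 1) + (\sum_i f i == 2))))%N; last first.
  rewrite -sum1_card; apply: eq_bigr => f _.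
  by case: (\sum_i f i)%N => [|[|[|]]].
have sumE (P : pred nat) :
    (\sum_(f in mults_below n l) P (\sum_i f i) =
     #|[set f in mults_below n l | P (\sum_i f i)]|)%N.
  rewrite -sum1_card -big_mkcondr /=.
  by apply: eq_bigl => f; rewrite [in RHS]inE.
by rewrite !big_split /= (sumE (leq 3)) (sumE (pred1 0%N)) (sumE (pred1 1%N))
           (sumE (pred1 2%N)) h0 h1 h2.
Qed.

Lemma eq_span (K : fieldType) (V : lmodType K) (S S' : V -> Prop) :
  (forall v, S v <-> S' v) -> forall v, Defs.span S v <-> Defs.span S' v.
Proof.
move=> SS' v; split; apply: span_elim; try exact: span0; move=> *;
  by [apply: span_lin | apply/span_gen/SS'].
Qed.

Lemma binz_nat (m k : int) (a b : nat) :
  m = a%:Z -> k = b%:Z -> binz m k = 'C(a, b)%:Z.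
Proof. by move=> -> ->. Qed.

(** * The three dimension formulas *)

Section Dimensions.
Variable K : fieldType.
Hypotheses (char_neq2 : 2%N \notin [pchar K]) (char_neq3 : 3%N \notin [pchar K]).

Lemma dim_multideg (r : nat) (l : 'I_r -> nat) :
  (0 < r)%N -> (forall i, (0 < l i)%N) ->
  exists2 d : nat, has_dim (@F_multideg K r l) d &
    d%:Z = (multinomial l)%:Z + \prod_(i < r) ((l i)%:Z + 1)
           - binz (r%:Z + 1) 2 - r%:Z - 1
           + #|[set i : 'I_r | l i == 1%N]|%:Z.
Proof.
move=> r0 l0; pose n := (\sum_i l i)%N.
pose Q (m : {ffun 'I_r -> nat}) := [forall i, m i == l i].
have n0 : (0 < n)%N by rewrite /n (bigD1 (Ordinal r0)) //= addn_gt0 l0.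
have dimW := has_dim_words Q char_neq2 char_neq3 n0.
exists (#|words_of_mult n l| + #|tail_index n Q|)%N.
  apply: eq_has_dim dimW => v; apply: eq_span => {}v; split=> -[w wl ->]; exists w => //.
    by move=> i; case: wl => _ /forallP/(_ i)/eqP <-; rewrite ffunE.
  have wm : mult (letters w) =1 l by move=> i; rewrite ffunE wl.
  split; last by apply/forallP => i; rewrite wm.
  by rewrite -sum_mult; apply: eq_bigr => i _; rewrite wm.
have -> : multinomial l = #|words_of_mult n l|.
  rewrite /multinomial -(@card_words_of_mult _ n l) // mulnK //.
  by rewrite prodn_gt0 // => i; rewrite fact_gt0.
have := card_tail_index_multideg (erefl n) (fun m => erefl (Q m)) l0.
have -> : \prod_(i < r) ((l i)%:Z + 1) = (\prod_i (l i).+1)%N%:Z.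
  rewrite (big_morph Posz PoszM (erefl 1%:Z)); apply: eq_bigr => i _.
  by rewrite -addn1 PoszD.
(* Trades the number of multiplicities above 1, which the count produces, for the number w of ones
   in the formula. *)
have w_r : (#|[set i | l i == 1%N]| + #|[set i | (1 < l i)%N]| = r)%N.
  rewrite -[RHS]card_ord -(cardC (fun i => l i == 1%N)) !cardsE; congr (_ + _)%N.
  by apply: eq_card => i; have := l0 i; rewrite !unfold_in /=; case: (l i) => [|[|]].
rewrite (@binz_nat _ _ r.+1 2) //; last by lia.
rewrite binS bin1; move: w_r.
move: #|[set i | l i == 1%N]| #|[set i | (1 < l i)%N]| #|words_of_mult n l| 
  #|tail_index n Q| (\prod_i (l i).+1)%N => w w2 c t p.
by lia.
Qed.

Lemma dim_deg (n r : nat) : (0 < n)%N -> (0 < r)%N ->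
  exists2 d : nat, has_dim (@F_deg K r n) d &
    d%:Z = r%:Z ^+ n + binz (n%:Z + 2 * r%:Z - 1) n%:Z
           - binz (r%:Z + 1) 2 * binz (n%:Z + r%:Z - 3) (n%:Z - 2)
           - r%:Z * binz (n%:Z + r%:Z - 2) (n%:Z - 1)
           - binz (n%:Z + r%:Z - 1) n%:Z.
Proof.
case: r => // r n0 _.
have dimW := has_dim_words (r := r.+1) predT char_neq2 char_neq3 n0.
exists (r.+1 ^ n + #|tail_index (r := r.+1) n predT|)%N.
  have cardT : #|[set t : n.-tuple 'I_r.+1 | predT (mult t)]| = (r.+1 ^ n)%N.
    by rewrite cardsT card_tuple card_ord.
  rewrite -cardT; apply: eq_has_dim dimW => v; apply: eq_span => {}v.
  by split=> -[w wn ->]; exists w => //; case: wn.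
have := @card_tail_index_all r n predT (frefl _) n0.
rewrite (@binz_nat (n%:Z + 2 * r.+1%:Z - 1) _ (n + (r + r.+1)) n) //; last by lia.
rewrite (@binz_nat (r.+1%:Z + 1) _ r.+2 2) //; last by lia.
rewrite (@binz_nat (n%:Z + r.+1%:Z - 1) _ (n + r) n) //; last by lia.
rewrite (@binz_nat (n%:Z + r.+1%:Z - 2) _ (n - 1 + r) (n - 1)); [|lia|lia].
have binC a b : 'C(a + b, b) = 'C(a + b, a) by rewrite -bin_sub ?leq_addl // addnK.
rewrite !binC -PoszM.
have -> : r.+1%:Z ^+ n = (r.+1 ^ n)%N%:Z by rewrite -!natz natrX.
case: n n0 {dimW} => [|[|n]] // _.
  (* For [n = 1] the lower index is -1, so the coefficient is 0 whatever the sign of the upper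
     index, in accordance with the factor [1 < n]. *)
  rewrite [binz (_ - 3) _](_ : _ = 0); last by case: (_ - 3).
  by rewrite mulr0; lia.
rewrite (@binz_nat _ _ (n.+2 - 2 + r) (n.+2 - 2)); [|lia|lia].
by rewrite -PoszM; lia.
Qed.

Lemma dim_multi (n : nat) : (0 < n)%N ->
  exists2 d : nat, has_dim (@F_multi K n) d &
    d%:Z = n`!%:Z + 2 ^+ n - binz (n%:Z + 1) 2 - 1.
Proof.
move=> n0; have [d dimF dE] := @dim_multideg n (fun=> 1%N) n0 (fun=> isT).
(* All multiplicities are 1, so w = n cancels the term -n, and the product becomes a power of 2. *)
exists d => //; rewrite dE /multinomial [(\sum__ _)%N]big_const_ord iter_addn_0 mul1n.
rewrite [(\prod__ _)%N]big1 // divn1 cardsT card_ord.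
rewrite (eq_bigr (fun=> 2)) // prodr_const card_ord.
by lia.
Qed.

End Dimensions.

Theorem theorem2p1 (K : closedFieldType)
    (char_neq2 : 2%N \notin [pchar K]) (char_neq3 : 3%N \notin [pchar K]) :
  (forall (r : nat) (l : 'I_r -> nat),
     (0 < r)%N -> (forall i, (0 < l i)%N) ->
     exists2 d : nat, has_dim (@F_multideg K r l) d &
       d%:Z = (multinomial l)%:Z + \prod_(i < r) ((l i)%:Z + 1)
              - binz (r%:Z + 1) 2 - r%:Z - 1
              + #|[set i : 'I_r | l i == 1%N]|%:Z)
  /\
  (forall n r : nat, (0 < n)%N -> (0 < r)%N ->
     exists2 d : nat, has_dim (@F_deg K r n) d &
       d%:Z = r%:Z ^+ n + binz (n%:Z + 2 * r%:Z - 1) n%:Z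
              - binz (r%:Z + 1) 2 * binz (n%:Z + r%:Z - 3) (n%:Z - 2)
              - r%:Z * binz (n%:Z + r%:Z - 2) (n%:Z - 1)
              - binz (n%:Z + r%:Z - 1) n%:Z)
  /\
  (forall n : nat, (0 < n)%N ->
     exists2 d : nat, has_dim (@F_multi K n) d &
       d%:Z = n`!%:Z + 2 ^+ n - binz (n%:Z + 1) 2 - 1).
Proof.
split; first exact: dim_multideg.
by split; [exact: dim_deg | exact: dim_multi].
Qed.
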